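(* Let $n\ge2$ and $\rho\ge1$ be integers, and let $\mathfrak n\subseteq\mathfrak{gl}(n+\rho|n)$ be the nilpotent subalgebra described in the context. Then $$\dim\operatorname{H}^2(\mathfrak n,\mathbb C)=\begin{cases}8n^2-12n+8,&\rho=1,\\ 8n^2-8n+8,&\rho=2,\\ 8n^2-8n+8+4n(\rho-2)+\dfrac{(\rho-3)^2+(\rho-3)}{2},&\rho>2.\end{cases}$$
   Context: All spaces are over $\mathbb C$. Put $m=n+\rho$. Rows and columns of matrices in $\mathfrak{gl}(m|n)$ are indexed by $\bar1,\dots,\bar m$ (even) and $1,\dots,n$ (odd); $E_{ab}$ are the elementary matrices, with supercommutator bracket $[E_{ab},E_{cd}]=\delta_{bc}E_{ad}-(-1)^{|E_{ab}||E_{cd}|}\delta_{da}E_{cb}$. The subalgebra $\mathfrak n$ is spanned by $E_{\bar i,\bar j}$ ($1\le i<j\le m$), $E_{i,j}$ ($1\le i<j\le n$), $E_{\bar i,j}$ ($1\le i\le m$, $1\le j\le n$, $i<j$), and $E_{i,\bar j}$ ($1\le i\le n$, $1\le j\le m$, $i<j$). $\operatorname{H}^\bullet(\mathfrak n,\mathbb C)$ is the Lie superalgebra cohomology with trivial (even, one-dimensional) coefficients, i.e. the cohomology of the complex $C^p=\operatorname{Hom}(\Lambda_s^p(\mathfrak n),\mathbb C)$ with $\Lambda_s^p(\mathfrak n)=\bigoplus_{i+j=p}\Lambda^i(\mathfrak n_{\bar0})\otimes S^j(\mathfrak n_{\bar1})$ and differential $$df(\omega_0\wedge\cdots\wedge\omega_p)=\sum_{i<j}(-1)^{\sigma_{i,j}}f([\omega_i,\omega_j]\wedge\omega_0\wedge\cdots\widehat{\omega_i}\cdots\widehat{\omega_j}\cdots\wedge\omega_p),$$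 $\sigma_{i,j}=i+j+|\omega_i||\omega_j|+|\omega_i|(|\omega_0|+\cdots+|\omega_{i-1}|)+|\omega_j|(|\omega_0|+\cdots+|\omega_{j-1}|)$. *)

(* Defs.v *)
From HB Require Import structures.
From mathcomp Require Import all_boot all_order all_algebra.
From mathcomp Require Import complex reals.

Set Implicit Arguments.
Unset Strict Implicit.
Unset Printing Implicit Defensive.

Import Order.TTheory GRing.Theory Num.Theory.
Local Open Scope ring_scope.

(* Cohomology, with coefficients in the trivial module F, of a Lie            *)
(* superalgebra given by a homogeneous basis B, the parity |x| = par x of its *)
(* elements, and the coordinates br x y z of the bracket [x, y] on z.         *)
Section Cohomology.

Variables (F : fieldType) (B : finType) (par : B -> bool).
Variable br : B -> B -> B -> F.

(* A total order on B in which the even elements precede the odd ones.        *)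
Definition before (x y : B) : bool :=
  (par x < par y)%N || ((par x == par y) && (enum_rank x <= enum_rank y)%N).

(* The standard basis of \bigoplus_(i + j = p) Lambda^i (even) (x) S^j (odd): *)
(* the products x_1 ... x_i y_1 ... y_j with x_1 < ... < x_i even and         *)
(* y_1 <= ... <= y_j odd.                                                     *)
Definition normal (t : seq B) : bool :=
  pairwise (fun x y => before x y && ((x != y) || par x)) t.

Definition monomial (p : nat) := {t : p.-tuple B | normal t}.

Definition super_ext (p : nat) := {ffun monomial p -> F^o}.

(* Two neighbours anticommute unless both are odd, in which case they         *)
(* commute.                                                                   *)
Definition num_swaps (p : nat) (t : p.-tuple B) : nat :=
  #|[set kl : 'I_p * 'I_p | [&& (kl.1 < kl.2)%N,
       ~~ before (tnth t kl.1) (tnth t kl.2)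
     & ~~ (par (tnth t kl.1) && par (tnth t kl.2))]]|.

(* The product t_0 /\ ... /\ t_(p-1) in Lambda_s^p; it vanishes when an even  *)
(* basis element is repeated, since sort before t is not normal then.         *)
Definition wedge (p : nat) (t : p.-tuple B) : super_ext p :=
  [ffun u : monomial p =>
     if sort before t == val u :> seq B then (-1) ^+ num_swaps t else 0].

Definition cochain (p : nat) := 'Hom(super_ext p, F^o).

Definition omit2 (p : nat) (w : p.-tuple B) (i j : 'I_p) : seq B :=
  [seq tnth w k | k <- enum 'I_p & (k != i) && (k != j)].

(* [w_i, w_j] /\ w_0 /\ ... (without w_i and w_j) ... /\ w_p, for i != j.     *)
Definition wedge_br (p : nat) (w : p.+1.-tuple B) (i j : 'I_p.+1) :
    super_ext p :=
  \sum_(z : B) br (tnth w i) (tnth w j) z *: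
     wedge [tuple nth z (z :: omit2 w i j) k | k < p].

Definition sigma (p : nat) (w : p.-tuple B) (i j : 'I_p) : nat :=
  let deg k := nat_of_bool (par (tnth w k)) in
  (i + j + deg i * deg j + deg i * (\sum_(k < p | (k < i)%N) deg k)
   + deg j * (\sum_(k < p | (k < j)%N) deg k))%N.

Definition diff_val (p : nat) (f : cochain p) (w : p.+1.-tuple B) : F^o :=
  \sum_(i < p.+1) \sum_(j < p.+1 | (i < j)%N)
     (-1) ^+ sigma w i j * f (wedge_br w i j).

Definition diff_form (p : nat) (f : cochain p) (v : super_ext p.+1) : F^o :=
  \sum_(u : monomial p.+1) v u * diff_val f (val u).

Fact diff_form_is_linear (p : nat) (f : cochain p) : linear (diff_form f).
Proof.
move=> a u v; rewrite /diff_form scaler_sumr -big_split /=.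
by apply: eq_bigr => t _; rewrite !ffunE mulrDl -mulrA.
Qed.

HB.instance Definition _ (p : nat) (f : cochain p) :=
  GRing.isLinear.Build F (super_ext p.+1) F^o _ (diff_form f)
    (diff_form_is_linear f).

Definition diff_fun (p : nat) (f : cochain p) : cochain p.+1 :=
  linfun (diff_form f).

Fact diff_fun_is_linear (p : nat) : linear (@diff_fun p).
Proof.
move=> a f g; apply/lfunP => v; rewrite add_lfunE scale_lfunE !lfunE /=.
rewrite /diff_form scaler_sumr -big_split /=; apply: eq_bigr => t _.
have -> : diff_val (a *: f + g) (val t)
          = a * diff_val f (val t) + diff_val g (val t).
  rewrite /diff_val mulr_sumr -big_split /=; apply: eq_bigr => i _.
  rewrite mulr_sumr -big_split /=; apply: eq_bigr => j _.
  by rewrite add_lfunE scale_lfunE mulrDr mulrCA.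
by rewrite mulrDr mulrCA.
Qed.

HB.instance Definition _ (p : nat) :=
  GRing.isLinear.Build F (cochain p) (cochain p.+1) _ (@diff_fun p)
    (@diff_fun_is_linear p).

Definition diff (p : nat) : 'Hom(cochain p, cochain p.+1) :=
  linfun (@diff_fun p).

Lemma diffE (p : nat) (f : cochain p) (v : super_ext p.+1) :
  diff p f v = \sum_(u : monomial p.+1) v u * diff_val f (val u).
Proof. by rewrite /diff lfunE /= /diff_fun lfunE. Qed.

(* H^p is realised as a complement of the coboundaries in the cocycles.       *)
Definition cohomology (p : nat) : {vspace cochain p} :=
  match p return {vspace cochain p} with
  | 0 => lker (diff 0)
  | q.+1 => (lker (diff q.+1) :\: limg (diff q))%VS
  end.

End Cohomology.

(* Rows and columns of gl(m|n) are indexed by 'I_(m + n): the first m indices *)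
(* are \bar 1, ..., \bar m (even), the last n ones are 1, ..., n (odd).       *)
Section GeneralLinear.

Variables (F : fieldType) (m n : nat).

Definition odd_idx (a : 'I_(m + n)) : bool :=
  if split a is inr _ then true else false.

(* Both \bar i and i are sent to i - 1.                                       *)
Definition idx_val (a : 'I_(m + n)) : nat :=
  match split a with inl i => i | inr i => i end.

Definition odd_elem (x : 'I_(m + n) * 'I_(m + n)) : bool :=
  odd_idx x.1 (+) odd_idx x.2.

(* [E_ab, E_cd] for x = (a, b) and y = (c, d).                                *)
Definition gl_bracket (x y : 'I_(m + n) * 'I_(m + n)) : 'M[F]_(m + n) :=
  (x.2 == y.1)%:R *: delta_mx x.1 y.2
  - (-1) ^+ (odd_elem x * odd_elem y)
      *: ((y.2 == x.1)%:R *: delta_mx y.1 x.2).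

(* The basis of n: its four families of elementary matrices E_ab are all      *)
(* given by the same strict inequality between the two indices.               *)
Definition nil_basis :=
  {x : 'I_(m + n) * 'I_(m + n) | (idx_val x.1 < idx_val x.2)%N}.

Definition nil_par (x : nil_basis) : bool := odd_elem (val x).

Definition nil_coord (x y z : nil_basis) : F :=
  gl_bracket (val x) (val y) (val z).1 (val z).2.

Lemma nil_bracketE (x y : nil_basis) :
  gl_bracket (val x) (val y)
  = \sum_(z : nil_basis) nil_coord x y z *: delta_mx (val z).1 (val z).2.
Proof.
apply/matrixP => a b; rewrite summxE.
case: (boolP (idx_val a < idx_val b)%N) => [lt_ab | nlt_ab].
  pose z0 : nil_basis := Sub (a, b) lt_ab.
  rewrite (bigD1 z0) //= big1 ?addr0 => [|z ne_z]; rewrite !mxE /nil_coord /=.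
    by rewrite !eqxx mulr1 !mxE.
  case: eqP => [ea|]; last by rewrite mulr0.
  case: eqP => [eb|]; last by rewrite mulr0.
  case/eqP: ne_z; apply: val_inj.
  by rewrite /= [val z]surjective_pairing -ea -eb.
rewrite big1 => [|z _]; last first.
  rewrite !mxE; case: eqP => [ea|]; last by rewrite mulr0.
  case: eqP => [eb|]; last by rewrite mulr0.
  by case/negP: nlt_ab; rewrite ea eb; exact: (valP z).
case: x y => [[x1 x2] /= ltx] [[y1 y2] /= lty]; rewrite /gl_bracket !mxE /=.
have Nab c d e : (idx_val c < idx_val d)%N -> (idx_val d < idx_val e)%N ->
    (a == c) && (b == e) = false.
  move=> lt1 lt2; apply/negP => /andP[/eqP ea /eqP eb].
  by case/negP: nlt_ab; rewrite ea eb; exact: ltn_trans lt1 lt2.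
case: (eqVneq x2 y1) => [e1|_]; case: (eqVneq y2 x1) => [e2|_];
  rewrite ?mul0r ?mulr0 ?subr0 //.
- rewrite (Nab x1 x2 y2) ?(Nab y1 y2 x2) ?mulr0 ?subr0 //.
    by rewrite e2.
  by rewrite e1.
- by rewrite (Nab x1 x2 y2) ?mulr0 // e1.
by rewrite (Nab y1 y2 x2) ?mulr0 ?subr0 // e2.
Qed.

Definition nil_cohomology (p : nat) := cohomology nil_par nil_coord p.

End GeneralLinear.

(* Main.v *)
Require Import Defs.
From HB Require Import structures.
From mathcomp Require Import all_boot all_order all_algebra.
From mathcomp Require Import complex reals.
From mathcomp Require Import zify ring lra.

Set Implicit Arguments.
Unset Strict Implicit.
Unset Printing Implicit Defensive.

Import Order.TTheory GRing.Theory Num.Theory.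
Local Open Scope ring_scope.

(* The second cohomology counts the relations of a minimal presentation of    *)
(* the algebra, which is generated by the E_ab with consecutive levels, where *)
(* both \bar i and i have level i. A 2-cocycle g is normalized by subtracting *)
(* the coboundary of the primitive E_ad |-> g(E_ac, E_cd), where c is the     *)
(* even index on the level just above a. The cocycle identity on E_ae, E_eb,  *)
(* E_cd then forces the normalized cocycle to vanish except on the pairs of   *)
(* generators (quadratic relations) and, around a level carrying only one     *)
(* index, on the pairs (E_ab, E_eb) and (E_ab, E_ce) of total degree 3 (Serre *)
(* relations). Conversely each of these pairs carries a cocycle that vanishes *)
(* on the others, so the dimension is the number of pairs. Pairs of           *)
(* generators whose product is E_ac E_cd with c even are left out, being used *)
(* up by the primitive.                                                       *)

(** * Cochains of degree 2 as super-skew forms *)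

(** A 2-cochain is the same thing as a super-skew form on the basis ([two_form_exists]). It is
    closed when its [jacobiator] vanishes and exact when it is a functional composed with the
    bracket ([cocycleP], [coboundaryP]). Closedness only has content on triples E_ae, E_eb, E_cd,
    which is [idx_cocycle].

    Evaluating the [normalized] form on all relation pairs is a linear map. On cocycles its kernel
    is the set of coboundaries: an exact form normalizes to zero ([coboundary_normalized]), and a
    cocycle whose normalization vanishes on relation pairs is exact ([normalized_eq0]). For the
    latter, either E_ab splits through an index that avoids E_cd, or two cocycle identities force a
    value to be its own opposite, or the pair is itself on the list. The map is onto because each
    relation pair has a dual cocycle ([relation_dual]). This gives [dim_cohomology2].

    It remains to count. Each of the m levels has an even index, and the first n levels also have an
    odd one, so there are 2n+rho-2 even and 2n-1 odd generators. Quadratic relations are unordered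
    pairs of generators, with squares only of odd ones, less one for each (a, d) two levels apart.
    The Serre relations number 0 for rho = 1 and 2 rho for rho at least 2 ([card_relation]). *)

Section Forms.

Variables (F : fieldType) (B : finType) (par : B -> bool).
Variable br : B -> B -> B -> F.

Definition koszul_sign (x y : B) : F := (-1) ^+ (par x && par y).

Lemma before_total : total (before par).
Proof.
move=> x y; rewrite /before; case: (par x) (par y) => [] [] //=; exact: leq_total.
Qed.

Lemma before_anti : antisymmetric (before par).
Proof.
move=> x y; rewrite /before; case: (par x) (par y) => [] [] //=;
  by rewrite ?andbF ?andFb // => H; apply/enum_rank_inj/val_inj/anti_leq.
Qed.

Lemma before_trans : transitive (before par).
Proof.
move=> y x z; rewrite /before; case: (par x) (par y) (par z) => [] [] [] //=;
  exact: leq_trans.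
Qed.

Lemma before_refl : reflexive (before par).
Proof. by move=> x; have := before_total x x; rewrite orbb. Qed.

Lemma num_swaps2 (x y : B) :
  num_swaps par [tuple x; y] = ~~ before par x y && ~~ (par x && par y).
Proof.
rewrite /num_swaps; set b := (X in _ = nat_of_bool X).
rewrite (_ : [set _ | _] = if b then [set (ord0, ord_max)] else set0).
  by case: b; rewrite ?cards1 ?cards0.
apply/setP => -[[[|[|[]]] //= i1] [[|[|[]]] //= i2]];
  rewrite inE /=; try (by case: b; rewrite !inE -?val_eqE).
  by rewrite -[X in par X && _]/x -[X in before _ X _]/x -[X in before _ _ X]/y
    -[X in _ && par X]/y -/b; case: b; rewrite !inE.
Qed.

Lemma sort2 (x y : B) :
  sort (before par) [:: x; y] = if before par x y then [:: x; y] else [:: y; x].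
Proof. by rewrite /sort /=; case: ifP. Qed.

Lemma normal2 (x y : B) :
  normal par [:: x; y] = before par x y && ((x != y) || par x).
Proof. by rewrite /normal /= !andbT. Qed.

Lemma wedge2_sym (x y : B) :
  wedge F par [tuple y; x] = - (koszul_sign x y *: wedge F par [tuple x; y]).
Proof.
apply/ffunP => u; rewrite !ffunE !sort2 !num_swaps2 /koszul_sign [par y && _]andbC.
have [->|nxy] := eqVneq x y.
  rewrite before_refl andbb; case pary: (par y); first by rewrite scaleN1r opprK.
  case: ifP => [/eqP e|_]; last by rewrite scaler0 oppr0.
  by have := valP u; rewrite /= -e normal2 eqxx pary andbF.
have := before_total x y; have := @before_anti x y.
case: (before par x y); case: (before par y x) => //=;
  try (by move=> /(_ isT) e; rewrite e eqxx in nxy) => _ _;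
  by case: (par x && par y); case: ifP => //= _;
     rewrite ?expr0 ?expr1 ?scaleN1r ?scale1r ?opprK ?oppr0.
Qed.

(** A normal tuple is already sorted and has no swap to count, so its wedge is a delta function;
    these are the basis vectors used in [super_extE]. *)
Lemma wedge_normal (p : nat) (u v : monomial par p) :
  wedge F par (val u) v = (u == v)%:R.
Proof.
have su : sort (before par) (val u) = val u :> seq B.
  apply: sorted_sort; first exact: before_trans.
  rewrite sorted_pairwise; last exact: before_trans.
  by apply: sub_pairwise (valP u) => x y /andP[].
rewrite ffunE su !val_eqE; case: ifP => // _.
rewrite /num_swaps eq_card0 ?expr0 // => -[k l]; rewrite !inE /=.
case: (ltnP k l) => //= lkl; case: k l lkl => k kp [l lp] /= lkl.
have x0 : B := tnth (val u) (Ordinal kp).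
have := valP u; rewrite /normal /= => /(pairwiseP x0)/(_ k l).
by rewrite !inE size_tuple !(tnth_nth x0) => /(_ kp lp lkl)/andP[->].
Qed.

Lemma super_extE (p : nat) (v : super_ext F par p) :
  v = \sum_(u : monomial par p) v u *: wedge F par (val u).
Proof.
apply/ffunP => w; rewrite sum_ffunE (bigD1 w) //= big1 => [|u uw].
  by rewrite ffunE wedge_normal eqxx addr0 /GRing.scale /= mulr1.
by rewrite ffunE wedge_normal (negPf uw) scaler0.
Qed.

Definition two_form (f : cochain F par 2) (x y : B) : F :=
  f (wedge F par [tuple x; y]).

Definition super_skew (g : B -> B -> F) := 
  forall x y, g y x = - (koszul_sign x y * g x y).

Lemma two_form_skew (f : cochain F par 2) : super_skew (two_form f).
Proof. by move=> x y; rewrite /two_form wedge2_sym linearN linearZ. Qed.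

Lemma tuple2P (t : 2.-tuple B) : t = [tuple tnth t ord0; tnth t ord_max].
Proof.
apply/eq_from_tnth => -[[|[|[]]] //= i];
  by rewrite [RHS](tnth_nth (tnth t ord0)) /=; congr tnth; apply: val_inj.
Qed.

Lemma tuple3P (t : 3.-tuple B) :
  t = [tuple tnth t ord0; tnth t (inord 1); tnth t ord_max].
Proof.
apply/eq_from_tnth => -[[|[|[|[]]]] //= i];
  by rewrite [RHS](tnth_nth (tnth t ord0)) /=; congr tnth; apply: val_inj; rewrite //= inordK.
Qed.

Lemma cochain_eq (p : nat) (f g : cochain F par p) :
  (forall u : monomial par p, f (wedge F par (val u)) = g (wedge F par (val u)))
  -> f = g.
Proof.
move=> fg; apply/lfunP => v; rewrite [v]super_extE !linear_sum.
by apply: eq_bigr => u _; rewrite !linearZ /= fg.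
Qed.

Definition extend (p : nat) (g : monomial par p -> F) (v : super_ext F par p) : F^o :=
  \sum_u v u * g u.

Fact extend_is_linear p (g : monomial par p -> F) : linear (extend g).
Proof.
move=> a u v; rewrite /extend scaler_sumr -big_split /=.
by apply: eq_bigr => t _; rewrite !ffunE mulrDl -mulrA.
Qed.

HB.instance Definition _ p (g : monomial par p -> F) :=
  GRing.isLinear.Build F (super_ext F par p) F^o _ (extend g) (extend_is_linear g).

Lemma cochain_exists p (g : monomial par p -> F) :
  exists f : cochain F par p, forall u, f (wedge F par (val u)) = g u.
Proof.
exists (linfun (extend g)) => u; rewrite lfunE /= /extend (bigD1 u) //= big1 => [|v vu].
  by rewrite wedge_normal eqxx mul1r addr0.
by rewrite wedge_normal eq_sym (negPf vu) mul0r.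
Qed.

Hypothesis F2 : (2%:R : F) != 0.

Lemma eq_oppr0 (x : F) : x = - x -> x = 0.
Proof.
by move=> e; apply/eqP; rewrite -(mulrI_eq0 _ (mulfI F2)) mulr_natl mulr2n {1}e addNr.
Qed.

Lemma skew_even (g : B -> B -> F) x : super_skew g -> ~~ par x -> g x x = 0.
Proof.
move=> sg px; apply: eq_oppr0; rewrite {1}sg /koszul_sign (negPf px) expr0 mul1r //.
Qed.

(** Values on normal pairs suffice: any other pair is a swap of one, or repeats an even element,
    where skewness forces 0 because 2 is invertible. *)
Lemma two_form_exists (g : B -> B -> F) :
  super_skew g -> exists f : cochain F par 2, two_form f =2 g.
Proof.
move=> sg; have [f fE] := cochain_exists (fun u : monomial par 2 => g (tnth (val u) ord0) (tnth (val u) ord_max)).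
exists f => x y.
suff H : forall x y, before par x y -> two_form f x y = g x y.
  case/orP: (before_total x y) => xy; first exact: H.
  by rewrite (two_form_skew f) H // [RHS]sg.
move=> {}x {}y xy.
have [nxy|] := boolP ((x != y) || par x); last first.
  by rewrite negb_or negbK => /andP[/eqP <- px]; rewrite !skew_even //; apply: two_form_skew.
have nt : normal par [tuple x; y] by rewrite normal2 xy.
by have := fE (Sub [tuple x; y] nt); rewrite SubK /two_form => ->; rewrite !(tnth_nth x).
Qed.

Lemma omit2_nth x0 p (w : p.-tuple B) (i j : 'I_p) :
  omit2 w i j = [seq nth x0 w k | k <- iota 0 p & (k != i :> nat) && (k != j :> nat)].
Proof.
rewrite -val_enum_ord filter_map -map_comp; apply: eq_map => k /=.
exact: tnth_nth.
Qed.

Lemma wedge_br_sum p (f : cochain F par p) (w : p.+1.-tuple B) (i j : 'I_p.+1) :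
  f (wedge_br par br w i j) = \sum_t br (tnth w i) (tnth w j) t *
    f (wedge F par [tuple nth t (t :: omit2 w i j) k | k < p]).
Proof. by rewrite /wedge_br linear_sum; apply: eq_bigr => t _; rewrite linearZ. Qed.

(** Minus the differential of [g] on x, y, z, with the bracket always in the first argument (see
    [diff_val3]). *)
Definition jacobiator (g : B -> B -> F) (x y z : B) : F :=
  \sum_t br x y t * g t z - koszul_sign y z * (\sum_t br x z t * g t y)
  + koszul_sign x y * koszul_sign x z * (\sum_t br y z t * g t x).

Lemma sigma_nth x0 p (w : p.-tuple B) (i j : 'I_p) :
  let deg k := nat_of_bool (par (nth x0 w k)) in
  let before k := sumn [seq deg l | l <- iota 0 k] in
  sigma par w i j = (i + j + deg i * deg j + deg i * before i + deg j * before j)%N.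
Proof.
have E (k : 'I_p) : (\sum_(l < p | (l < k)%N) par (tnth w l))%N
    = sumn [seq nat_of_bool (par (nth x0 w l)) | l <- index_iota 0 k].
  under eq_bigr do rewrite (tnth_nth x0).
  rewrite -(big_mkord (fun l => l < k)%N (fun l => nat_of_bool (par (nth x0 w l)))).
  by rewrite sumnE big_map -/(index_iota 0 k) (big_nat_widen 0 k p) // ltnW.
by move=> deg before; rewrite /sigma !E /index_iota !subn0 !(tnth_nth x0).
Qed.

Lemma diff_val2 (f : cochain F par 1) x y :
  diff_val br f [tuple x; y] = - \sum_t br x y t * f (wedge F par [tuple t]).
Proof.
rewrite /diff_val; under eq_bigr do rewrite big_mkcond.
rewrite !big_ord_recl !big_ord0 !wedge_br_sum !(omit2_nth x) !(sigma_nth x) !(tnth_nth x) /= !add0r !addr0.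
rewrite -signr_odd -[RHS]mulN1r; congr (_ * _).
  by case: (par x); case: (par y); rewrite ?expr1.
apply: eq_bigr => t _; congr (_ * f (wedge _ _ _)).
by apply: eq_from_tnth => i; rewrite tnth_mktuple (tnth_nth x) !ord1.
Qed.

Lemma diff_val3 (f : cochain F par 2) x y z :
  diff_val br f [tuple x; y; z] = - jacobiator (two_form f) x y z.
Proof.
rewrite /diff_val; under eq_bigr do rewrite big_mkcond.
rewrite !big_ord_recl !big_ord0 !wedge_br_sum !(omit2_nth x) !(sigma_nth x) !(tnth_nth x) /= !add0r !addr0.
have T (t u : B) : [tuple nth t [:: t; u] k | k < 2] = [tuple t; u].
  by apply: eq_from_tnth => -[[|[|[]]] //= k]; rewrite tnth_mktuple (tnth_nth x).
rewrite /jacobiator /koszul_sign !opprD opprK -!addrA; congr (_ + (_ + _)).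
- rewrite -[RHS]mulN1r; congr (_ * _).
    by rewrite -signr_odd; case: (par x); case: (par y); rewrite ?expr1.
  by apply: eq_bigr => t _; rewrite T.
- congr (_ * _).
    by rewrite -signr_odd; case: (par x); case: (par y); case: (par z); rewrite ?expr1.
  by apply: eq_bigr => t _; rewrite T.
rewrite -mulNr; congr (_ * _).
  by rewrite -signr_odd; case: (par x); case: (par y); case: (par z);
    rewrite /= ?expr0 ?expr1 ?mulN1r ?mul1r ?opprK.
by apply: eq_bigr => t _; rewrite T.
Qed.

Hypothesis br_skew : forall x y t, br y x t = - (koszul_sign x y * br x y t).

Lemma jacobiator_swapl g x y z : super_skew g ->
  jacobiator g y x z = - (koszul_sign x y * jacobiator g x y z).
Proof.
move=> sg; rewrite /jacobiator.
have -> : \sum_t br y x t * g t z = - (koszul_sign x y * \sum_t br x y t * g t z).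
  by rewrite mulr_sumr -sumrN; apply: eq_bigr => t _; rewrite br_skew mulNr mulrA.
rewrite /koszul_sign [par y && par x]andbC.
by case: (par x); case: (par y); case: (par z); rewrite /=; ring.
Qed.

Lemma jacobiator_swapr g x y z : super_skew g ->
  jacobiator g x z y = - (koszul_sign y z * jacobiator g x y z).
Proof.
move=> sg; rewrite /jacobiator.
have -> : \sum_t br z y t * g t x = - (koszul_sign y z * \sum_t br y z t * g t x).
  by rewrite mulr_sumr -sumrN; apply: eq_bigr => t _; rewrite br_skew mulNr mulrA.
rewrite /koszul_sign [par z && par y]andbC.
by case: (par x); case: (par y); case: (par z); rewrite /=; ring.
Qed.

(** An adjacent swap changes the jacobiator by a sign only, so a triple may be sorted first. A
    sorted triple repeating an even element gives a value equal to its opposite. *)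
Lemma jacobiator_normal g : super_skew g ->
  (forall x y z, normal par [:: x; y; z] -> jacobiator g x y z = 0) ->
  forall x y z, jacobiator g x y z = 0.
Proof.
move=> sg H0.
have Sl x y z : jacobiator g x y z = 0 -> jacobiator g y x z = 0.
  by move=> e; rewrite jacobiator_swapl // e mulr0 oppr0.
have Sr x y z : jacobiator g x y z = 0 -> jacobiator g x z y = 0.
  by move=> e; rewrite jacobiator_swapr // e mulr0 oppr0.
have H1 x y z : before par x y -> before par y z -> jacobiator g x y z = 0.
  move=> xy yz; have [nxy|] := boolP ((x != y) || par x); last first.
    rewrite negb_or negbK => /andP[/eqP <- px]; apply: eq_oppr0.
    by rewrite {1}jacobiator_swapl // /koszul_sign (negPf px) mul1r.
  have [nyz|] := boolP ((y != z) || par y); last first.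
    rewrite negb_or negbK => /andP[/eqP <- py]; apply: eq_oppr0.
    by rewrite {1}jacobiator_swapr // /koszul_sign (negPf py) mul1r.
  have xz := before_trans xy yz.
  have [nxz|] := boolP ((x != z) || par x); last first.
    rewrite negb_or negbK => /andP[/eqP xz0 px].
    have exy : x = y by apply: before_anti; rewrite xy xz0.
    by rewrite exy eqxx -exy (negPf px) in nxy.
  by apply: H0; rewrite /normal /= xy xz yz nxy nxz nyz.
move=> x y z; have := before_total x y; have := before_total y z.
have := before_total x z.
case xz: (before par x z); case yz: (before par y z); case xy: (before par x y) => //=; move=> *.
(* The six alternatives are the elements of S_3 as words in the two adjacent transpositions. *)
all: first [exact: H1 | apply: (Sl); exact: H1 | apply: (Sr); exact: H1
  | apply: (Sl); apply: (Sr); exact: H1 | apply: (Sr); apply: (Sl); exact: H1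
  | apply: (Sl); apply: (Sr); apply: (Sl); exact: H1].
Qed.

Lemma cocycleP (f : cochain F par 2) :
  reflect (forall x y z, jacobiator (two_form f) x y z = 0) (f \in lker (diff par br 2)).
Proof.
rewrite memv_ker; apply: (iffP eqP) => [df0 | J0].
  apply: jacobiator_normal; first exact: two_form_skew.
  move=> x y z nt.
  have [u uE] : exists u : monomial par 3, val u = [tuple x; y; z].
    by exists (Sub [tuple x; y; z] nt); rewrite SubK.
  have := diffE br f (wedge F par (val u)).
  rewrite df0 lfunE /= (bigD1 u) //= big1 => [|v vu].
    rewrite wedge_normal eqxx mul1r addr0 uE diff_val3 => /esym/eqP.
    by rewrite oppr_eq0 => /eqP.
  by rewrite wedge_normal eq_sym (negPf vu) mul0r.
apply/lfunP => v; rewrite diffE lfunE /= big1 // => u _.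
by rewrite (tuple3P (val u)) diff_val3 J0 oppr0 mulr0.
Qed.

Lemma coboundaryP (f : cochain F par 2) :
  (exists h : B -> F, forall x y, two_form f x y = \sum_t br x y t * h t)
  <-> f \in limg (diff par br 1).
Proof.
split.
  (* The sign compensates the one in [diff_val2]. *)
  move=> [h hE]; have [k kE] := cochain_exists (fun u : monomial par 1 => - h (tnth (val u) ord0)).
  have kE' t : k (wedge F par [tuple t]) = - h t.
    have nt : normal par [tuple t] by [].
    by have := kE (Sub [tuple t] nt); rewrite SubK => ->.
  apply/memv_imgP; exists k; first exact: memvf.
  apply: cochain_eq => u; rewrite diffE (bigD1 u) //= big1 => [|v vu].
    rewrite wedge_normal eqxx mul1r addr0 (tuple2P (val u)) diff_val2.
    rewrite -/(two_form f _ _) hE -sumrN; apply: eq_bigr => t _.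
    by rewrite kE' mulrN opprK.
  by rewrite wedge_normal eq_sym (negPf vu) mul0r.
case/memv_imgP => k _ ->; exists (fun t => - k (wedge F par [tuple t])) => x y.
suff H : forall x y, before par x y -> two_form (diff par br 1 k) x y = \sum_t br x y t * - k (wedge F par [tuple t]).
  case/orP: (before_total x y) => xy; first exact: H.
  rewrite two_form_skew H // mulr_sumr -sumrN; apply: eq_bigr => t _.
  by rewrite [in RHS]br_skew mulrA mulNr.
move=> {}x {}y xy.
have [nxy|] := boolP ((x != y) || par x); last first.
  rewrite negb_or negbK => /andP[/eqP <- px]; rewrite skew_even //; last exact: two_form_skew.
  rewrite big1 // => t _; rewrite (eq_oppr0 (x := br x x t)) ?mul0r //.
  by rewrite {1}br_skew /koszul_sign (negPf px) mul1r.
have nt : normal par [tuple x; y] by rewrite normal2 xy.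
have [u uE] : exists u : monomial par 2, val u = [tuple x; y].
  by exists (Sub [tuple x; y] nt); rewrite SubK.
rewrite /two_form -uE diffE (bigD1 u) //= big1 => [|v vu].
  rewrite wedge_normal eqxx mul1r addr0 uE diff_val2 -sumrN.
  by apply: eq_bigr => t _; rewrite mulrN.
by rewrite wedge_normal eq_sym (negPf vu) mul0r.
Qed.

End Forms.

(** On Z the map L has kernel Z :&: C, and its image contains a nonzero multiple of each coordinate
    vector. Rank-nullity then gives #|K| as the codimension of Z :&: C in Z. *)
Lemma dim_diffv_dual (F : fieldType) (V : vectType F) (Z C : {vspace V})
    (K : finType) (L : 'Hom(V, {ffun K -> F^o})) :
  (forall f, f \in Z -> (f \in C) = (L f == 0)) ->
  (forall k, exists2 f, f \in Z & L f k != 0 /\ forall l, l != k -> L f l = 0) ->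
  \dim (Z :\: C) = #|K|.
Proof.
move=> ker_L surj_L.
have -> : #|K| = \dim (L @: Z).
  rewrite (_ : L @: Z = fullv)%VS; last first.
    apply/eqP; rewrite eqEsubv subvf; apply/subvP => v _.
    have -> : v = \sum_k v k *: [ffun l => (l == k)%:R : F^o].
      apply/ffunP => l; rewrite sum_ffunE (bigD1 l) //= big1 => [|k kl].
        by rewrite !ffunE eqxx addr0 /GRing.scale /= mulr1.
      by rewrite !ffunE eq_sym (negPf kl) scaler0.
    apply: memv_suml => k _; apply: memvZ; have [f fZ [fk fl]] := surj_L k.
    have -> : [ffun l => (l == k)%:R : F^o] = (L f k)^-1 *: L f.
      apply/ffunP => l; rewrite !ffunE; case: eqP => [->|/eqP/fl ->].
        by rewrite /GRing.scale /= mulVf.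
      by rewrite scaler0.
    by apply: memvZ; apply: memv_img.
  by rewrite dimvf /= /dim /= muln1.
apply/eqP; rewrite -(eqn_add2l (\dim (Z :&: C))) dimv_cap_compl -(limg_ker_dim L Z).
rewrite eqn_add2r; apply/eqP; congr (\dim _); apply/vspaceP => f.
by rewrite !memv_cap memv_ker; case: (boolP (f \in Z)) => //= fZ; rewrite ker_L.
Qed.

(** * Coordinates on elementary matrices *)

Section Indices.

Variables m n : nat.
Implicit Types a b c d e : 'I_(m + n).

Lemma idx_inj a b : idx_val a = idx_val b -> odd_idx a = odd_idx b -> a = b.
Proof.
rewrite -[a]splitK -[b]splitK /idx_val /odd_idx !unsplitK.
by case: (split a) (split b) => [i|i] [j|j] // /val_inj ->.
Qed.

Lemma odd_idx_lt a : odd_idx a -> (idx_val a < n)%N.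
Proof. by rewrite /idx_val /odd_idx; case: (split a). Qed.

Lemma even_idx_lt a : ~~ odd_idx a -> (idx_val a < m)%N.
Proof. by rewrite /idx_val /odd_idx; case: (split a). Qed.

Lemma even_idx_ex k : (k < m)%N -> exists2 a : 'I_(m + n), idx_val a = k & ~~ odd_idx a.
Proof.
move=> km; exists (lshift n (Ordinal km));
  by rewrite /idx_val /odd_idx -[lshift _ _]/(unsplit (inl _)) unsplitK.
Qed.

Lemma odd_idx_ex k : (k < n)%N -> exists2 a : 'I_(m + n), idx_val a = k & odd_idx a.
Proof.
move=> km; exists (rshift m (Ordinal km));
  by rewrite /idx_val /odd_idx -[rshift _ _]/(unsplit (inr _)) unsplitK.
Qed.

End Indices.

Section Coordinates.

Variables (F : fieldType) (m n : nat).
Local Notation I := 'I_(m + n).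
Local Notation nilb := (Defs.nil_basis m n).
Local Notation lv := (@idx_val m n).
Local Notation od := (@odd_idx m n).
Local Notation par := (@nil_par m n).
Local Notation br := (@nil_coord F m n).
Implicit Types (a b c d e : I) (x y z : nilb) (g : nilb -> nilb -> F).

(* ext1 h a b is h(E_ab), and 0 when E_ab does not belong to the algebra. *)
Definition ext1 (h : nilb -> F) (a b : I) : F := oapp h 0 (insub (a, b)).

Definition ext2 g a b c d : F := ext1 (fun x => ext1 (g x) c d) a b.

Lemma ext1_val h x : ext1 h (val x).1 (val x).2 = h x.
Proof. by rewrite /ext1 -surjective_pairing valK. Qed.

Lemma ext1_out h a b : (lv b <= lv a)%N -> ext1 h a b = 0.
Proof. by move=> ba; rewrite /ext1 insubF //= ltnNge ba. Qed.

Lemma ext1_sum h a b :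
  \sum_t (delta_mx a b : 'M[F]_(m + n)) (val t).1 (val t).2 * h t = ext1 h a b.
Proof.
rewrite /ext1; case: insubP => [x _ xE|nab] /=.
  rewrite (bigD1 x) //= big1 ?addr0 => [|y yx]; rewrite !mxE.
    by rewrite xE !eqxx mul1r.
  case: andP => [[/eqP e1 /eqP e2]|]; last by rewrite mul0r.
  by case/eqP: yx; apply: val_inj; rewrite xE -e1 -e2 -surjective_pairing.
rewrite big1 // => y _; rewrite !mxE; case: andP => [[/eqP e1 /eqP e2]|]; last by rewrite mul0r.
by case/negP: nab; rewrite -e1 -e2; apply: (valP y).
Qed.

Lemma bracket_sum h x y :
  \sum_t br x y t * h t =
    ((val x).2 == (val y).1)%:R * ext1 h (val x).1 (val y).2
    - koszul_sign F par x y * (((val y).2 == (val x).1)%:R * ext1 h (val y).1 (val x).2).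
Proof.
rewrite -!ext1_sum !mulr_sumr -sumrB; apply: eq_bigr => t _.
rewrite /nil_coord /gl_bracket !mxE mulnb /koszul_sign /nil_par mulrBl.
by rewrite !mulrA.
Qed.

Lemma nil_coord_skew x y t : br y x t = - (koszul_sign F par x y * br x y t).
Proof.
rewrite /nil_coord /gl_bracket !mxE !mulnb /koszul_sign /nil_par [odd_elem (val y) && _]andbC.
by case: (odd_elem _ && _); rewrite ?expr1 ?expr0; ring.
Qed.

Lemma ext2_skew g a b c d : super_skew par g ->
  ext2 g c d a b = - ((-1) ^+ ((od a (+) od b) && (od c (+) od d)) * ext2 g a b c d).
Proof.
move=> sg; rewrite /ext2 /ext1.
case: insubP => [x _ xE|_] /=; case: insubP => [y _ yE|_] /=; rewrite ?mulr0 ?oppr0 //.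
by rewrite sg /koszul_sign /nil_par xE yE.
Qed.

(* The cocycle identity on E_ae, E_eb and E_cd, solved for g(E_ab, E_cd); up  *)
(* to permutation these are the only triples on which it is not trivial.      *)
Definition idx_cocycle g := forall a e b c d,
  (lv a < lv e)%N -> (lv e < lv b)%N -> (lv c < lv d)%N ->
  ext2 g a b c d =
    (-1) ^+ ((od e (+) od b) && (od c (+) od d)) *
      ((e == c)%:R * ext2 g a d e b
       - (-1) ^+ ((od a (+) od e) && (od c (+) od d)) * ((d == a)%:R * ext2 g c e e b))
    - (-1) ^+ ((od a (+) od e) && (od e (+) od b)) * (-1) ^+ ((od a (+) od e) && (od c (+) od d)) *
      ((b == c)%:R * ext2 g e d a e
       - (-1) ^+ ((od e (+) od b) && (od c (+) od d)) * ((d == e)%:R * ext2 g c b a e)).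

Lemma ext2_val g x a b : ext1 (g^~ x) a b = ext2 g a b (val x).1 (val x).2.
Proof. by rewrite /ext2 /ext1; case: insub => //= y; rewrite -surjective_pairing valK. Qed.

Lemma jacobiator_ext2 g a e b c d
  (ae : (lv a < lv e)%N) (eb : (lv e < lv b)%N) (cd : (lv c < lv d)%N) :
  jacobiator par br g (Sub (a, e) ae) (Sub (e, b) eb) (Sub (c, d) cd) =
  ext2 g a b c d -
    (-1) ^+ ((od e (+) od b) && (od c (+) od d)) *
      ((e == c)%:R * ext2 g a d e b
       - (-1) ^+ ((od a (+) od e) && (od c (+) od d)) * ((d == a)%:R * ext2 g c e e b))
    + (-1) ^+ ((od a (+) od e) && (od e (+) od b)) * (-1) ^+ ((od a (+) od e) && (od c (+) od d)) *
      ((b == c)%:R * ext2 g e d a e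
       - (-1) ^+ ((od e (+) od b) && (od c (+) od d)) * ((d == e)%:R * ext2 g c b a e)).
Proof.
rewrite /jacobiator !(bracket_sum (g^~ _)) !ext2_val /koszul_sign /nil_par !SubK /odd_elem /= eqxx.
by rewrite (_ : (b == a) = false) ?mul1r ?mul0r ?mulr0 ?subr0 //; apply/eqP => E; have := ltn_trans ae eb; rewrite E ltnn.
Qed.

(** If no two of the three matrices compose, all brackets vanish. Otherwise a permutation puts a
    composable pair E_ae, E_eb in front. *)
Lemma jacobiator_idx_cocycle g : super_skew par g ->
  (forall x y z, jacobiator par br g x y z = 0) <-> idx_cocycle g.
Proof.
move=> sg; split=> [J0 a e b c d ae eb cd | M].
  have := J0 (Sub (a, e) ae) (Sub (e, b) eb) (Sub (c, d) cd).
  rewrite jacobiator_ext2 => /eqP; rewrite -addrA addr_eq0 => /eqP ->; ring.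
have Q x y z : (val x).2 = (val y).1 -> jacobiator par br g x y z = 0.
  case: x y z => [[a e] ae] [[e' b] eb] [[c d] cd] /= E; subst e'.
  rewrite jacobiator_ext2 (M a e b c d ae eb cd); ring.
have Sl x y z : jacobiator par br g x y z = 0 -> jacobiator par br g y x z = 0.
  by move=> e; rewrite (jacobiator_swapl _ _ _ _ sg) ?e ?mulr0 ?oppr0 //; apply: nil_coord_skew.
have Sr x y z : jacobiator par br g x y z = 0 -> jacobiator par br g x z y = 0.
  by move=> e; rewrite (jacobiator_swapr _ _ _ _ sg) ?e ?mulr0 ?oppr0 //; apply: nil_coord_skew.
move=> x y z.
have [e|/eqP/negPf xy] := (val x).2 =P (val y).1; first exact: Q.
have [e|/eqP/negPf yx] := (val y).2 =P (val x).1; first by apply: (Sl); exact: Q.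
have [e|/eqP/negPf yz] := (val y).2 =P (val z).1; first by apply: (Sl); apply: (Sr); apply: Q.
have [e|/eqP/negPf zy] := (val z).2 =P (val y).1; first by apply: (Sr); apply: (Sl); apply: (Sr); apply: Q.
have [e|/eqP/negPf xz] := (val x).2 =P (val z).1; first by apply: (Sr); apply: Q.
have [e|/eqP/negPf zx] := (val z).2 =P (val x).1; first by apply: (Sr); apply: (Sl); apply: Q.
by rewrite /jacobiator !(bracket_sum (g^~ _)) xy yx xz zx yz zy !mul0r !mulr0 !subr0 !mulr0 subr0 addr0.
Qed.

End Coordinates.

(** * Cocycles are determined by their values on relation pairs *)

Section Support.

Variables (m n : nat).
Local Notation lv := (@idx_val m n).
Local Notation od := (@odd_idx m n).
Local Notation par := (@nil_par m n).
Implicit Types x y : Defs.nil_basis m n.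

Definition simple x := lv (val x).2 == (lv (val x).1).+1.

(* The pairs E_ac, E_cd from which the primitive is read off. *)
Definition via_even x y := ((val x).2 == (val y).1) && ~~ od (val x).2.

Definition quadratic_pair x y :=
  [&& simple x, simple y, ~~ via_even x y & ~~ via_even y x].

(* [E_eb, [E_ae, E_eb]] = 0, where E_ab is a multiple of [E_ae, E_eb] and e is *)
(* the only index of its level; x = E_ab and y = E_eb.                        *)
Definition serre_out x y :=
  [&& (n <= (lv (val x).1).+1)%N, lv (val x).2 == (lv (val x).1).+2,
      (val y).2 == (val x).2 & lv (val y).1 == (lv (val x).1).+1].

(* [E_ce, [E_ae, E_eb]] = 0; x = E_ab and y = E_ce. Exchanging a and c gives   *)
(* the same relation up to sign, and a trivial one if a = c is odd, whence     *)
(* the restriction to c even.                                                 *)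
Definition serre_in x y :=
  [&& (n <= (lv (val x).1).+1)%N, lv (val x).2 == (lv (val x).1).+2,
      lv (val y).1 == lv (val x).1, ~~ od (val y).1
    & lv (val y).2 == (lv (val x).1).+1].

Definition relation_pair x y :=
  [|| quadratic_pair x y && (before par x y && ((x != y) || par x)),
      serre_out x y | serre_in x y].

End Support.

Section Core.

Variables (F : fieldType) (m n : nat).
Local Notation I := 'I_(m + n).
Local Notation nilb := (Defs.nil_basis m n).
Local Notation lv := (@idx_val m n).
Local Notation od := (@odd_idx m n).
Local Notation par := (@nil_par m n).
Local Notation br := (@nil_coord F m n).
Implicit Types (a b c d e : I) (x y z : nilb) (g : nilb -> nilb -> F).

Lemma even_idx_ge a : (n <= lv a)%N -> od a = false.
Proof. by move=> h; apply/negbTE; apply: contraL h => /odd_idx_lt; rewrite ltnNge. Qed.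

Lemma idx_inj_ge a b : (n <= lv a)%N -> lv a = lv b -> a = b.
Proof. by move=> h e; apply: idx_inj => //; rewrite !even_idx_ge // -e. Qed.

Lemma lv_neq a b : lv a != lv b -> (a == b) = false.
Proof. by move=> h; apply/negbTE; apply: contra h => /eqP ->. Qed.

(* The sum has at most one term. *)
Definition primitive g a d : F :=
  \sum_(e | ~~ od e && (lv e == (lv a).+1)) ext2 g a e e d.

Lemma primitiveE g a e d :
  ~~ od e -> lv e = (lv a).+1 -> primitive g a d = ext2 g a e e d.
Proof.
move=> oe le; rewrite /primitive (big_pred1 e) // => e'.
apply/andP/eqP => [[oe' /eqP le']|->]; last by rewrite oe le.
by apply: idx_inj; rewrite ?le ?le' // (negPf oe) (negPf oe').
Qed.

Lemma ext2_out g a b c d : (lv d <= lv c)%N -> ext2 g a b c d = 0.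
Proof. by move=> dc; rewrite /ext2 {1}/ext1; case: insub => //= x; exact: ext1_out. Qed.

Lemma ext1_primitive g a d :
  ext1 (fun t : nilb => primitive g (val t).1 (val t).2) a d = primitive g a d.
Proof.
have [ad|da] := ltnP (lv a) (lv d).
  by rewrite /ext1 insubT.
rewrite ext1_out // /primitive big1 // => e /andP[_ /eqP e1].
by rewrite ext2_out // e1; lia.
Qed.

Definition normalized g x y : F :=
  g x y - \sum_t br x y t * primitive g (val t).1 (val t).2.

Lemma normalized_skew g : super_skew par g -> super_skew par (normalized g).
Proof.
move=> sg x y; rewrite /normalized sg mulrBr opprB [RHS]addrC mulr_sumr -sumrN.
congr (_ + _); apply: eq_bigr => t _.
by rewrite nil_coord_skew mulNr opprK mulrA.
Qed.

Lemma normalized_ext2 g x y : normalized g x y =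
  ext2 g (val x).1 (val x).2 (val y).1 (val y).2
  - (((val x).2 == (val y).1)%:R * primitive g (val x).1 (val y).2
     - koszul_sign F par x y * (((val y).2 == (val x).1)%:R * primitive g (val y).1 (val x).2)).
Proof.
rewrite /normalized (bracket_sum (fun t => primitive g (val t).1 (val t).2)).
by rewrite !ext1_primitive /ext2 ext1_val ext1_val.
Qed.

(** * A normalized cocycle that vanishes on relation pairs is zero *)

Section Vanishing.

Hypotheses (F2 : (2%:R : F) != 0) (lt_nm : (n < m)%N).

Lemma idx_lt a : (lv a < m)%N.
Proof.
case: (boolP (od a)) => [/odd_idx_lt|/even_idx_lt] // h; exact: ltn_trans h lt_nm.
Qed.

Variable g : nilb -> nilb -> F.
Hypotheses (sg : super_skew par g) (Mg : idx_cocycle g).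
Hypothesis vanish : forall x y, relation_pair x y -> normalized g x y = 0.
Local Notation G := (ext2 g).

(** E_ab is the bracket of E_ae and E_eb, and under these inequalities both factors supercommute
    with E_cd. *)
Lemma G_free_index a e b c d : (lv a < lv e)%N -> (lv e < lv b)%N -> (lv c < lv d)%N ->
  e != c -> e != d -> b != c -> d != a -> G a b c d = 0.
Proof.
move=> ae eb cd ec ed bc da; rewrite (Mg ae eb cd).
rewrite [d == e]eq_sym (negPf ec) (negPf ed) (negPf bc) (negPf da).
by rewrite !mul0r !mulr0 !subr0 !mulr0 subr0.
Qed.

(** The cocycle identity on E_ae, E_eb, E_bd: the index at which E_ad is cut can be moved to a lower
    level. *)
Lemma G_through a e b d : (lv a < lv e)%N -> (lv e < lv b)%N -> (lv b < lv d)%N ->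
  G a b b d = G a e e d.
Proof.
move=> ae eb bd; rewrite (Mg ae eb bd) eqxx.
rewrite !(lv_neq (a := e)) ?(lv_neq (a := d)); try lia.
rewrite (ext2_skew a e e d sg).
by case: (od a) (od e) (od b) (od d) => [] [] [] [] /=; ring.
Qed.

(* The two values are equal by one instance of the cocycle identity and       *)
(* opposite by another.                                                       *)
Lemma G_chain a p q d : (lv a < lv p)%N -> (lv p < lv q)%N -> (lv q < lv d)%N ->
  od p = false -> od q = false -> G a q p d = 0 /\ G a d p q = 0.
Proof.
move=> ap pq qd op oq.
have E1 : G a q p d = G a d p q.
  rewrite (Mg ap pq (ltn_trans pq qd)) op oq eqxx /=.
  rewrite (lv_neq (a := d)) ?(lv_neq (a := q)) ?(lv_neq (a := d)); try lia.
  by rewrite /=; ring.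
have E2 : G a d p q = - G a q p d.
  rewrite (Mg (ltn_trans ap pq) qd pq) eqxx.
  rewrite (lv_neq (a := q)) ?(lv_neq (a := q)) ?(lv_neq (a := d)); try lia.
  rewrite (ext2_skew a q p d sg) op oq.
  by case: (od a) (od d) => [] [] /=; ring.
have E : G a q p d = 0 by apply: (eq_oppr0 F2); rewrite {1}E1.
by rewrite -E1 E.
Qed.

Lemma vanish_quadratic x y : quadratic_pair x y -> normalized g x y = 0.
Proof.
have H x' y' : quadratic_pair x' y' -> before par x' y' -> normalized g x' y' = 0.
  move=> q b; have [nxy|] := boolP ((x' != y') || par x').
    by apply: vanish; rewrite /relation_pair q b nxy.
  rewrite negb_or negbK => /andP[/eqP <- px].
  exact: (skew_even F2 (normalized_skew sg) px).
move=> q; case/orP: (before_total par x y) => b; first exact: H.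
rewrite (normalized_skew sg) H ?mulr0 ?oppr0 //.
by move: q; rewrite /quadratic_pair => /and4P[-> -> -> ->].
Qed.

Lemma G_serre_out a e b : (n <= lv e)%N -> lv e = (lv a).+1 -> lv b = (lv a).+2 ->
  G a b e b = 0.
Proof.
move=> ne le lb.
have ab : (lv a < lv b)%N by lia.
have eb : (lv e < lv b)%N by lia.
have := @vanish (Sub (a, b) ab) (Sub (e, b) eb).
rewrite normalized_ext2 /relation_pair /serre_out !SubK /= -le ne lb le !eqxx !orbT => /(_ isT).
rewrite (lv_neq (a := b)) ?(lv_neq (a := b)); try lia.
by rewrite !mul0r !mulr0 !subr0.
Qed.

Lemma G_serre_in a c e b : (n <= lv e)%N -> lv e = (lv a).+1 -> lv b = (lv a).+2 ->
  lv c = lv a -> G a b c e = 0.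
Proof.
move=> ne le lb lc.
have E c' a' : lv a' = lv a -> lv c' = lv a -> od c' = false -> G a' b c' e = 0.
  move=> la' lc' oc'.
  have ab : (lv a' < lv b)%N by lia.
  have eb : (lv c' < lv e)%N by lia.
  have := @vanish (Sub (a', b) ab) (Sub (c', e) eb).
  rewrite normalized_ext2 /relation_pair /serre_in !SubK /= la' lc' oc' -le ne lb le !eqxx !orbT => /(_ isT).
  rewrite (lv_neq (a := b)) ?(lv_neq (a := e)); try lia.
  by rewrite !mul0r !mulr0 !subr0.
case oc: (od c); last exact: E.
have ob : od b = false by apply: even_idx_ge; lia.
have oe : od e = false by apply: even_idx_ge.
(* The identity on E_ae, E_eb, E_ce exchanges a and c. With c odd, an even a reduces to the case
   above, and an odd a equals c, so the value is its own opposite. *)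
have R : G a b c e = (-1) ^+ od a * G c b a e.
  rewrite (Mg (_ : lv a < lv e)%N (_ : lv e < lv b)%N (_ : lv c < lv e)%N); try lia.
  rewrite eqxx (lv_neq (a := e)) ?(lv_neq (a := e)) ?(lv_neq (a := b)); try lia.
  by rewrite ob oe oc; case: (od a) => /=; ring.
case oa: (od a); last by rewrite R E ?mulr0.
have ac : a = c by apply: idx_inj => //; rewrite oa oc.
by apply: (eq_oppr0 F2); rewrite {1}R oa ac mulN1r.
Qed.

(** The value on a composable pair does not depend on the cut. [G_through] settles every cut except
    the odd index just above a. *)
Lemma G_through_primitive a b d : (lv a < lv b)%N -> (lv b < lv d)%N ->
  G a b b d = primitive g a d.
Proof.
move=> ab bd; have dm := idx_lt d.
have [e le oe] : exists2 e : I, lv e = (lv a).+1 & ~~ od e by apply: even_idx_ex; lia.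
have [eb|be] := ltnP (lv e) (lv b).
  by rewrite (primitiveE _ _ oe le) (G_through (e := e)) // le.
have lb : lv b = (lv a).+1 by lia.
have [ob|ob] := boolP (od b); last by rewrite (primitiveE _ _ ob lb).
have [d3|d2] := ltnP (lv a).+2 (lv d).
  (* There is room for a third cut e' above both b and e, and each of the two can be compared with
     it. *)
  have [e' le' oe'] : exists2 e : I, lv e = (lv a).+2 & ~~ od e by apply: even_idx_ex; lia.
  rewrite (primitiveE _ _ oe le) -(G_through (e := b) (b := e')); try lia.
  by rewrite (G_through (e := e)) //; lia.
(* With d only two levels above a, the pair consists of generators meeting in an odd index. It is a
   quadratic pair, and its vanishing is exactly the claim. *)
have := @vanish_quadratic (Sub (a, b) ab) (Sub (b, d) bd).
rewrite normalized_ext2 /quadratic_pair /simple /via_even !SubK /= lb eqxx ob.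
have -> : lv d == (lv a).+2 by lia.
rewrite (lv_neq (a := d)) ?(lv_neq (a := d)); try lia.
by rewrite eqxx mul0r mulr0 subr0 mul1r => /(_ isT)/eqP; rewrite subr_eq0 => /eqP.
Qed.

(** The even index just above a is the first candidate for [G_free_index]. If it is c or d, the odd
    index of the same level replaces it when that level is below n. Otherwise the level two above a
    is tried, and what remains is a chain or a Serre configuration. *)
Lemma G_commuting_deg2 a b c d : ((lv a).+1 < lv b)%N -> (lv c < lv d)%N ->
  b != c -> d != a -> G a b c d = 0.
Proof.
move=> ab cd bc da; have bm := idx_lt b.
have [e le oe] : exists2 e : I, lv e = (lv a).+1 & ~~ od e by apply: even_idx_ex; lia.
have ae : (lv a < lv e)%N by lia.
have eb : (lv e < lv b)%N by lia.
have [ec|ec] := eqVneq e c.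
  subst e; have [cn|nc] := ltnP (lv c) n.
    have [o lo oo] := odd_idx_ex m cn.
    apply: (G_free_index (e := o)); rewrite ?lo //; apply/eqP => E; subst o.
      by rewrite oo in oe.
    by rewrite lo ltnn in cd.
  have oc := even_idx_ge nc.
  have [b3|b2] := ltnP (lv a).+2 (lv b).
    have [p lp op] : exists2 e : I, lv e = (lv a).+2 & ~~ od e by apply: even_idx_ex; lia.
    have [pd|pd] := eqVneq p d; last first.
      by apply: (G_free_index (e := p)) => //; try lia; apply/eqP => E; subst p; lia.
    subst p; apply: (proj2 (@G_chain a c d b _ _ _ _ _)) => //; [lia|exact/negbTE].
  have [db|db] := eqVneq d b; first by subst d; apply: G_serre_out => //; lia.
  have db' : lv d <> lv b by move=> E; case/eqP: db; apply: idx_inj_ge; lia.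
  apply: (proj1 (@G_chain a c b d _ _ _ _ _)) => //; [lia|apply: even_idx_ge; lia].
have [ed|ed] := eqVneq e d; last exact: (G_free_index (e := e)).
subst e; have [dn|nd] := ltnP (lv d) n.
  have [o lo oo] := odd_idx_ex m dn.
  apply: (G_free_index (e := o)); rewrite ?lo //; apply/eqP => E; subst o.
    by rewrite lo ltnn in cd.
  by rewrite oo in oe.
have [b3|b2] := ltnP (lv a).+2 (lv b).
  have [p lp op] : exists2 e : I, lv e = (lv a).+2 & ~~ od e by apply: even_idx_ex; lia.
  by apply: (G_free_index (e := p)) => //; try lia; apply/eqP => E; subst p; lia.
have [ca|ca] := eqVneq (lv c) (lv a); first by apply: G_serre_in => //; lia.
(* Here c lies strictly below the level of a, so E_cd is split instead: through the even index on
   the level of a if a is odd, and by [G_chain] if a is even. *)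
rewrite (ext2_skew c d a b sg) (_ : G c d a b = 0) ?mulr0 ?oppr0 //.
have [oa|oa] := boolP (od a).
  have [p lp op] : exists2 e : I, lv e = lv a & ~~ od e by apply: even_idx_ex; lia.
  apply: (G_free_index (e := p)); rewrite ?lp //; try lia.
  - by apply/eqP => E; subst p; rewrite oa in op.
  - by apply/eqP => E; subst p; lia.
apply: (proj1 (@G_chain c a d b _ _ _ _ _)) => //; [lia|exact/negbTE|exact/negbTE].
Qed.

Lemma G_commuting a b c d : (lv a < lv b)%N -> (lv c < lv d)%N ->
  b != c -> d != a -> G a b c d = 0.
Proof.
move=> ab cd bc da.
have [b2|b1] := ltnP (lv a).+1 (lv b); first exact: G_commuting_deg2.
have [d2|d1] := ltnP (lv c).+1 (lv d).
  by rewrite (ext2_skew c d a b sg) G_commuting_deg2 ?mulr0 ?oppr0 // eq_sym.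
have := @vanish_quadratic (Sub (a, b) ab) (Sub (c, d) cd).
rewrite normalized_ext2 /quadratic_pair /simple /via_even !SubK /=.
rewrite (negPf bc) (negPf da) /= !mul0r mulr0 !subr0 => ->//.
by rewrite !andbT; apply/andP; split; lia.
Qed.

Lemma normalized_eq0 x y : normalized g x y = 0.
Proof.
rewrite normalized_ext2; case: x y => [[a b] ab] [[c d] cd] /=.
rewrite /koszul_sign /nil_par /odd_elem /=.
have [bc|bc] := eqVneq b c.
  subst c; rewrite (lv_neq (a := d)); last by rewrite gtn_eqF // (ltn_trans ab).
  by rewrite mul0r mulr0 subr0 mul1r G_through_primitive ?subrr.
have [da|da] := eqVneq d a; last by rewrite G_commuting // !mul0r mulr0 !subr0.
subst d; rewrite (ext2_skew c a a b sg) G_through_primitive // mul0r mul1r sub0r opprK.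
by rewrite [X in (-1) ^+ nat_of_bool X]andbC addNr.
Qed.

End Vanishing.

End Core.

(** * Dual cocycles *)

Section Dual.

Variables (F : fieldType) (m n : nat).
Local Notation I := 'I_(m + n).
Local Notation nilb := (Defs.nil_basis m n).
Local Notation lv := (@idx_val m n).
Local Notation od := (@odd_idx m n).
Local Notation par := (@nil_par m n).
Local Notation br := (@nil_coord F m n).
Implicit Types (a b c d e : I) (x y z u v : nilb) (g : nilb -> nilb -> F).

(** The wedge of the coordinate functionals of u and v. For u = v odd its value at (u, u) is 2. *)
Definition dual_form u v x y : F :=
  ((x == u) && (y == v))%:R - koszul_sign F par u v * ((x == v) && (y == u))%:R.

Lemma dual_form_skew u v : super_skew par (dual_form u v).
Proof.
move=> x y; rewrite /dual_form [(y == u) && _]andbC [(y == v) && _]andbC.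
case: (@andP (x == u)) => [[/eqP -> /eqP ->]|_].
  by rewrite /koszul_sign; case: (par u && par v); case: (_ && _); rewrite /=; ring.
case: andP => [[/eqP -> /eqP ->]|_]; last by rewrite /=; ring.
by rewrite /koszul_sign [par v && _]andbC; case: (par u && par v); rewrite /=; ring.
Qed.

Lemma ext2_dual_form u v a b c d :
  ext2 (dual_form u v) a b c d =
    (((a, b) == val u) && ((c, d) == val v))%:R
    - koszul_sign F par u v * (((a, b) == val v) && ((c, d) == val u))%:R.
Proof.
have ne (w : nilb) p q : ~~ (lv p < lv q)%N -> ((p, q) == val w) = false.
  by move=> h; apply/negbTE; apply: contra h => /eqP E; have := valP w; rewrite -E.
rewrite /ext2 {1}/ext1; case: insubP => [x _ xE|nab] /=; last first.
  by rewrite ![(a, b) == _]ne //= mulr0 subr0.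
rewrite /ext1; case: insubP => [y _ yE|ncd] /=; last first.
  by rewrite ![(c, d) == _]ne // !andbF mulr0 subr0.
by rewrite /dual_form -xE -yE !val_eqE.
Qed.

Lemma ext2D g h a b c d :
  ext2 (fun x y => g x y + h x y) a b c d = ext2 g a b c d + ext2 h a b c d.
Proof.
by rewrite /ext2 /ext1; case: insub => [x|] /=; case: insub => [y|] /=; rewrite ?addr0.
Qed.

Lemma ext2Z k g a b c d :
  ext2 (fun x y => k * g x y) a b c d = k * ext2 g a b c d.
Proof.
by rewrite /ext2 /ext1; case: insub => [x|] /=; case: insub => [y|] /=; rewrite ?mulr0.
Qed.

Lemma primitive_linear k g h a d :
  primitive (fun x y => k * g x y + h x y) a d = k * primitive g a d + primitive h a d.
Proof.
rewrite /primitive mulr_sumr -big_split; apply: eq_bigr => e _.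
by rewrite ext2D ext2Z.
Qed.

Lemma normalized_linear k g h x y :
  normalized (fun x y => k * g x y + h x y) x y = k * normalized g x y + normalized h x y.
Proof.
rewrite /normalized; under eq_bigr do rewrite primitive_linear mulrDr.
rewrite big_split /= mulrBr opprD addrACA mulr_sumr; congr (_ - _ + _).
by apply: eq_bigr => t _; rewrite mulrCA.
Qed.

Lemma normalized_ext g h x y : g =2 h -> normalized g x y = normalized h x y.
Proof.
move=> gh; rewrite !normalized_ext2.
have E a b c d : ext2 g a b c d = ext2 h a b c d.
  by rewrite /ext2 /ext1; case: insub => //= ?; case: insub => //= ?.
have E' a d : primitive g a d = primitive h a d by apply: eq_bigr.
by rewrite E !E'.
Qed.

Lemma normalized_closed g : (forall a e d, ~~ od e -> ext2 g a e e d = 0) ->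
  normalized g =2 g.
Proof.
move=> g0 x y; rewrite normalized_ext2 /ext2 !ext1_val.
have p0 a d : primitive g a d = 0 by apply: big1 => e /andP[oe _]; exact: g0.
by rewrite !p0 !mulr0 subr0 subr0.
Qed.

(** Each relation is listed in one order only: quadratic pairs follow [before], and Serre pairs put
    the element of degree 2 first. *)
Lemma relation_pair_anti u v :
  relation_pair u v -> relation_pair v u -> u = v.
Proof.
rewrite /relation_pair /quadratic_pair /serre_out /serre_in /simple.
case/or3P => [|/and4P[_ /eqP h1 /eqP h2 /eqP h3]|/and5P[_ /eqP h1 /eqP h2 _ /eqP h3]].
- case/andP=> /and4P[/eqP su /eqP sv _ _] /andP[uv _].
  case/or3P => [|/and4P[_ /eqP h1 /eqP h2 /eqP h3]|/and5P[_ /eqP h1 /eqP h2 _ /eqP h3]]; try lia.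
  by case/andP => _ /andP[vu _]; apply: (@before_anti _ par); rewrite uv vu.
- have {}h2 := congr1 lv h2.
  by case/or3P => [/andP[/and4P[/eqP su /eqP sv _ _] _]|/and4P[_ /eqP h1' /eqP h2' /eqP h3']|/and5P[_ /eqP h1' /eqP h2' _ /eqP h3']]; lia.
by case/or3P => [/andP[/and4P[/eqP su /eqP sv _ _] _]|/and4P[_ /eqP h1' /eqP h2' /eqP h3']|/and5P[_ /eqP h1' /eqP h2' _ /eqP h3']]; lia.
Qed.

Lemma dual_form_self (F2 : (2%:R : F) != 0) u v : relation_pair u v -> dual_form u v u v != 0.
Proof.
move=> r; rewrite /dual_form !eqxx; have [uv|_] := eqVneq u v; last first.
  by rewrite mulr0 subr0 oner_eq0.
subst v; suff pu : par u by rewrite /koszul_sign pu /= expr1 mulr1 opprK.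
move: r; rewrite /relation_pair eqxx /= => /or3P[/and3P[]//|/and4P[_ /eqP h1 _ /eqP h3]|/and5P[_ /eqP h1 /eqP h2 _ /eqP h3]]; lia.
Qed.

Lemma dual_form_other u v x y : relation_pair u v -> relation_pair x y ->
  (x, y) != (u, v) -> dual_form u v x y = 0.
Proof.
move=> ruv rxy ne; rewrite /dual_form.
case: andP => [[/eqP xu /eqP yv]|_]; first by rewrite xu yv eqxx in ne.
case: andP => [[/eqP xu /eqP yv]|_]; last by rewrite mulr0 subr0.
subst x y; have uv := relation_pair_anti ruv rxy.
by rewrite uv eqxx in ne.
Qed.

(** Every term of the identity has an argument spanning at least two levels, so a form living on
    pairs of generators is closed for degree reasons. *)
Lemma idx_cocycle_deg2 g : (forall a b c d, ext2 g a b c d != 0 ->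
    lv b = (lv a).+1 /\ lv d = (lv c).+1) -> idx_cocycle g.
Proof.
move=> s a e b c d ae eb cd.
have Z a' b' c' d' : ((lv a').+1 < lv b')%N \/ ((lv c').+1 < lv d')%N -> ext2 g a' b' c' d' = 0.
  by move=> h; apply/eqP; apply/negPn/negP => /s[]; lia.
rewrite Z; last by left; lia.
have -> : (e == c)%:R * ext2 g a d e b = 0.
  case: eqP => [E|_]; rewrite ?mul0r // mul1r Z //; left; subst c; lia.
have -> : (d == a)%:R * ext2 g c e e b = 0.
  case: eqP => [E|_]; rewrite ?mul0r // mul1r Z //; left; subst d; lia.
have -> : (b == c)%:R * ext2 g e d a e = 0.
  case: eqP => [E|_]; rewrite ?mul0r // mul1r Z //; left; subst c; lia.
have -> : (d == e)%:R * ext2 g c b a e = 0.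
  case: eqP => [E|_]; rewrite ?mul0r // mul1r Z //; left; subst e; lia.
by rewrite !mulr0 subr0 !mulr0 subr0.
Qed.

Lemma quadratic_dual u v : quadratic_pair u v ->
  idx_cocycle (dual_form u v) /\ normalized (dual_form u v) =2 dual_form u v.
Proof.
case/and4P => /eqP su /eqP sv nuv nvu; split.
  apply: idx_cocycle_deg2 => a b c d; rewrite ext2_dual_form.
  case: andP => [[/eqP E1 /eqP E2] _|_]; first by rewrite -E1 in su; rewrite -E2 in sv.
  case: andP => [[/eqP E1 /eqP E2] _|_]; last by rewrite mulr0 subr0 eqxx.
  by rewrite -E2 in su; rewrite -E1 in sv.
apply: normalized_closed => a e d oe; rewrite ext2_dual_form.
case: andP => [[/eqP E1 /eqP E2]|_].
  by case/negP: nuv; rewrite /via_even -E1 -E2 /= eqxx oe.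
case: andP => [[/eqP E1 /eqP E2]|_]; last by rewrite mulr0 subr0.
by case/negP: nvu; rewrite /via_even -E1 -E2 /= eqxx oe.
Qed.

Lemma serre_out_dual u v : serre_out u v ->
  idx_cocycle (dual_form u v) /\ normalized (dual_form u v) =2 dual_form u v.
Proof.
case: u v => [[a0 b0] ab0] [[e0 b1] eb0]; set u := exist _ _ _; set v := exist _ _ _.
case/and4P => /= nle /eqP lb /eqP E /eqP le; subst b1.
have oe : od e0 = false by apply: even_idx_ge; lia.
have ob : od b0 = false by apply: even_idx_ge; lia.
have E1 a b c d : ((lv a).+1 < lv b)%N -> ext2 (dual_form u v) a b c d =
    [&& a == a0, b == b0, c == e0 & d == b0]%:R.
  move=> ab; rewrite ext2_dual_form /= !xpair_eqE -!andbA.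
  rewrite (_ : [&& a == e0, _ & _] = false) ?mulr0 ?subr0 //.
  by apply/negbTE/negP => /and3P[/eqP ? /eqP ? _]; subst; lia.
have E2 p q r : ext2 (dual_form u v) p q q r = 0.
  rewrite ext2_dual_form /= !xpair_eqE.
  case: andP => [[/andP[_ /eqP hq] /andP[/eqP h _]]|_]; first by move: (congr1 lv hq) (congr1 lv h); lia.
  case: andP => [[/andP[_ /eqP hq] /andP[/eqP h _]]|_]; first by move: (congr1 lv hq) (congr1 lv h); lia.
  by rewrite mulr0 subr0.
split; last by apply: normalized_closed.
move=> a e b c d ae eb cd.
have -> : ext2 (dual_form u v) e d a e = 0.
  by rewrite (ext2_skew a e e d (dual_form_skew u v)) E2 mulr0 oppr0.
rewrite E2 !mulr0 sub0r subr0 E1; last lia.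
have -> : (d == e)%:R * ext2 (dual_form u v) c b a e = 0.
  case: eqP => [?|_]; rewrite ?mul0r // mul1r E1; last by subst e; lia.
  case: and4P => // -[/eqP ? /eqP ? /eqP ? /eqP ?]; subst; lia.
rewrite mulr0 oppr0 mulr0 subr0.
case: and4P => [[/eqP ? /eqP ? /eqP ? /eqP ?]|nE].
  (* Only e0 lies strictly between the levels of a0 and b0, so the identity reads 1 = 1. *)
  subst a b c d; have -> : e = e0 by apply: idx_inj_ge; lia.
  by rewrite eqxx E1 ?lb // !eqxx oe ob /= mul1r mul1r.
case: (e =P c) => [?|_]; last by rewrite mul0r mulr0.
subst c; rewrite E1; last lia.
case: and4P => [[/eqP ? /eqP ? /eqP ? /eqP ?]|_]; last by rewrite !mulr0.
by case: nE; subst; rewrite !eqxx.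
Qed.

(** The cocycle identity ties the value at (E_ab, E_ce) to that at (E_cb, E_ae), so the dual form is
    symmetrized in a and c. The sign is + because c is even. *)
Lemma serre_in_dual (F2 : (2%:R : F) != 0) u v : serre_in u v -> relation_pair u v ->
  exists g, [/\ super_skew par g, idx_cocycle g, normalized g =2 g, g u v != 0
    & forall x y, relation_pair x y -> (x, y) != (u, v) -> g x y = 0].
Proof.
case: u v => [[a0 b0] ab0] [[c0 e0] ce0]; set u := exist _ _ _; set v := exist _ _ _.
case/and5P => /= nle /eqP lb /eqP lc oc /eqP le ruv.
have oe : od e0 = false by apply: even_idx_ge; lia.
have ob : od b0 = false by apply: even_idx_ge; lia.
have cb0 : (lv c0 < lv b0)%N by lia.
have ae0 : (lv a0 < lv e0)%N by lia.
pose u' : nilb := Sub (c0, b0) cb0; pose v' : nilb := Sub (a0, e0) ae0.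
pose g x y := dual_form u v x y + dual_form u' v' x y.
have gs : super_skew par g.
  by move=> x y; rewrite /g (dual_form_skew u v) (dual_form_skew u' v'); ring.
have E1 a b c d : ((lv a).+1 < lv b)%N -> ext2 g a b c d =
    ((b == b0) && (d == e0))%:R * (((a == a0) && (c == c0))%:R + ((a == c0) && (c == a0))%:R).
  move=> ab; rewrite ext2D !ext2_dual_form !SubK /= !xpair_eqE.
  have Fab p : lv p = lv a0 -> (a == p) && (b == e0) = false.
    by move=> lp; apply/negbTE/negP => /andP[/eqP/(congr1 lv) ? /eqP/(congr1 lv)]; lia.
  rewrite !Fab //= !mulr0 !subr0.
  by case: (a == a0); case: (c == c0); case: (a == c0); case: (c == a0); case: (b == b0);
    case: (d == e0); rewrite /=; ring.
have E2 p q r : ext2 g p q q r = 0.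
  rewrite ext2D !ext2_dual_form !SubK /= !xpair_eqE.
  do 4 (case: andP => [[/andP[_ /eqP hq] /andP[/eqP h _]]|_];
    first by move: (congr1 lv hq) (congr1 lv h); lia).
  by rewrite !mulr0 !subr0 addr0.
exists g; split=> //.
- move=> a e b c d ae eb cd.
  have -> : ext2 g e d a e = 0 by rewrite (ext2_skew a e e d gs) E2 mulr0 oppr0.
  rewrite E2 !mulr0 sub0r subr0 E1; last lia.
  have -> : (e == c)%:R * ext2 g a d e b = 0.
    case: eqP => [?|_]; rewrite ?mul0r // mul1r E1; last by subst e; lia.
    subst c; rewrite (_ : (a == a0) && _ = false); last first.
      by apply/negbTE/negP => /andP[/eqP/(congr1 lv) ? /eqP/(congr1 lv)]; lia.
    rewrite (_ : (a == c0) && _ = false); last first.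
      by apply/negbTE/negP => /andP[/eqP/(congr1 lv) ? /eqP/(congr1 lv)]; lia.
    by rewrite addr0 mulr0.
  rewrite mulr0 add0r mulrN opprK.
  have [/andP[/eqP eb0 /eqP ed0]|nbd] := boolP ((b == b0) && (d == e0)); last first.
    case: (d =P e) => [ed|_]; last by rewrite !mul0r !mulr0.
    rewrite E1; last by subst e; lia.
    by rewrite -ed (negPf nbd) !mul0r !mulr0.
  subst b d; have [ac|nac] := boolP ((a == a0) && (c == c0) || (a == c0) && (c == a0)); last first.
    rewrite negb_or in nac; case/andP: nac => /negPf n1 /negPf n2.
    rewrite n1 n2 addr0 mulr0; case: (e0 =P e) => [ee|_]; last by rewrite !mul0r !mulr0.
    rewrite E1; last by subst e; lia.
    by rewrite [(c == a0) && _]andbC [(c == c0) && _]andbC n1 n2 addr0 !mulr0.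
  have la : lv a = lv a0 by case/orP: ac => /andP[/eqP-> _].
  have -> : e = e0 by apply: idx_inj_ge; lia.
  have oac : od a && od c = false.
    by case/orP: ac => /andP[/eqP-> /eqP->]; rewrite (negPf oc) ?andbF.
  rewrite E1; last lia.
  rewrite !eqxx oe ob [(c == a0) && _]andbC [(c == c0) && _]andbC !addbF oac.
  by rewrite andbF /=; ring.
- exact: normalized_closed.
- have uv : (u == v) = false.
    by rewrite -val_eqE /= xpair_eqE; apply/negbTE/negP => /andP[_ /eqP/(congr1 lv)]; lia.
  have uv' : (u == v') = false.
    by rewrite -val_eqE /= xpair_eqE; apply/negbTE/negP => /andP[_ /eqP/(congr1 lv)]; lia.
  rewrite /g /dual_form !eqxx uv uv' /= !mulr0 !subr0.
  (* The value is 2 if a0 = c0 and 1 otherwise. *)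
  by case: (_ && _); rewrite /= ?addr0 ?oner_eq0 // -mulr2n.
move=> x y rxy ne; rewrite /g (dual_form_other ruv rxy ne) add0r /dual_form.
case: andP => [[/eqP xu /eqP yv]|_].
  (* The mirrored pair is listed only if a0 is even, and then it is the pair (u, v) itself. *)
  subst x y; case/negP: ne; suff ac : a0 = c0.
    by apply/eqP; congr (_, _); apply: val_inj; rewrite /= ac.
  apply: idx_inj; rewrite ?lc // (negPf oc); apply/negbTE.
  move: rxy; rewrite /relation_pair /quadratic_pair /simple /serre_out /serre_in !SubK /=.
  case/or3P => [/andP[/and4P[/eqP h _ _ _] _]|/and4P[_ _ /eqP/(congr1 lv) h _]|/and5P[]//]; lia.
case: andP => [[/eqP xu /eqP yv]|_]; last by rewrite mulr0 subr0.
subst x y; move: rxy.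
rewrite /relation_pair /quadratic_pair /simple /serre_out /serre_in !SubK /=.
case/or3P => [/andP[/and4P[_ /eqP h _ _] _]|/and4P[_ /eqP h _ _]|/and5P[_ /eqP h _ _ _]]; lia.
Qed.

End Dual.

(** * The dimension is the number of relation pairs *)

Section Dimension.

Variables (F : fieldType) (m n : nat).
Local Notation nilb := (Defs.nil_basis m n).
Local Notation lv := (@idx_val m n).
Local Notation od := (@odd_idx m n).
Local Notation par := (@nil_par m n).
Local Notation br := (@nil_coord F m n).

Definition relation := {xy : nilb * nilb | relation_pair xy.1 xy.2}.

Definition relation_values (f : cochain F par 2) : {ffun relation -> F^o} :=
  [ffun k => normalized (two_form f) (val k).1 (val k).2].

Fact relation_values_is_linear : linear relation_values.
Proof.
move=> a f g; apply/ffunP => k; rewrite !ffunE.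
rewrite -normalized_linear; apply: normalized_ext => x y.
by rewrite /two_form add_lfunE scale_lfunE.
Qed.

HB.instance Definition _ :=
  GRing.isLinear.Build F (cochain F par 2) {ffun relation -> F^o} _
    relation_values relation_values_is_linear.

Hypotheses (F2 : (2%:R : F) != 0) (lt_nm : (n < m)%N).

(** For f the coboundary of h, the primitive agrees with h on elements spanning at least two levels,
    and every bracket is a combination of those. *)
Lemma coboundary_normalized (f : cochain F par 2) :
  f \in limg (diff par br 1) -> forall x y, normalized (two_form f) x y = 0.
Proof.
move=> /(coboundaryP F2 (@nil_coord_skew F m n)) [h hE] x y.
have P a d : ((lv a).+1 < lv d)%N -> primitive (two_form f) a d = ext1 h a d.
  move=> ad; have dm := idx_lt lt_nm d.
  have [e le oe] : exists2 e, lv e = (lv a).+1 & ~~ od e by apply: even_idx_ex; lia.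
  have ae : (lv a < lv e)%N by lia.
  have ed : (lv e < lv d)%N by lia.
  rewrite (primitiveE _ _ oe le) -[ext2 _ _ _ _ _]/(ext2 _ (val (Sub (a, e) ae : nilb)).1
    (val (Sub (a, e) ae : nilb)).2 (val (Sub (e, d) ed : nilb)).1 (val (Sub (e, d) ed : nilb)).2).
  rewrite /ext2 !ext1_val hE bracket_sum !SubK /= eqxx (lv_neq (a := d)); last lia.
  by rewrite mul1r mul0r mulr0 subr0.
rewrite /normalized hE (bracket_sum (fun t => primitive (two_form f) (val t).1 (val t).2)).
rewrite bracket_sum !ext1_primitive.
have xlt := valP x; have ylt := valP y.
have P' (u v : nilb) : ((val u).2 == (val v).1)%:R * ext1 h (val u).1 (val v).2
    = ((val u).2 == (val v).1)%:R * primitive (two_form f) (val u).1 (val v).2.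
  case: eqP => [E|_]; last by rewrite !mul0r.
  by rewrite P //; move: (valP u) (valP v) (congr1 lv E); lia.
by rewrite !P' subrr.
Qed.

Lemma relation_dual (k : relation) :
  exists g : nilb -> nilb -> F, [/\ super_skew par g, idx_cocycle g, normalized g =2 g,
    g (val k).1 (val k).2 != 0
    & forall l : relation, l != k -> g (val l).1 (val l).2 = 0].
Proof.
case: k => [[u v] /= ruv].
have ne (l : relation) : l != Sub (u, v) ruv -> ((val l).1, (val l).2) != (u, v).
  by rewrite -val_eqE -surjective_pairing.
have dual : idx_cocycle (dual_form F u v) /\ normalized (dual_form F u v) =2 dual_form F u v ->
  exists g : nilb -> nilb -> F, [/\ super_skew par g, idx_cocycle g, normalized g =2 g, g u v != 0
    & forall l : relation, l != Sub (u, v) ruv -> g (val l).1 (val l).2 = 0].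
  case=> M N; exists (dual_form F u v); split => //.
  - exact: dual_form_skew.
  - exact: dual_form_self.
  by move=> l /ne; apply: dual_form_other => //; exact: (valP l).
case/or3P: (ruv) => [/andP[q _]|s|s].
- exact: (dual (quadratic_dual F q)).
- exact: (dual (serre_out_dual F s)).
have [g [gs gM gN g0 gl]] := serre_in_dual F2 s ruv.
exists g; split=> // l /ne; apply: gl; exact: (valP l).
Qed.

Theorem dim_cohomology2 : \dim (nil_cohomology F m n 2) = #|{: relation}|.
Proof.
have BS := @nil_coord_skew F m n.
apply: (dim_diffv_dual (L := linfun relation_values)) => [f fZ | k].
  have fM : idx_cocycle (two_form f).
    by apply/(jacobiator_idx_cocycle (two_form_skew f)); apply/(cocycleP F2 BS).
  apply/idP/eqP => [fB | f0].
    by apply/ffunP => k; rewrite lfunE /= !ffunE coboundary_normalized.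
  apply/(coboundaryP F2 BS).
  exists (fun t => primitive (two_form f) (val t).1 (val t).2) => x y.
  apply/eqP; rewrite -subr_eq0 -/(normalized _ x y); apply/eqP.
  apply: normalized_eq0 => // [|u v ruv]; first exact: two_form_skew.
  have := congr1 (fun z : {ffun relation -> F^o} => z (Sub (u, v) ruv)) f0.
  by rewrite lfunE /= !ffunE.
have [g [gs gM gN g0 gl]] := relation_dual k.
have [f fE] := two_form_exists F2 gs.
have fN x y : normalized (two_form f) x y = g x y.
  by rewrite (normalized_ext _ _ fE) gN.
exists f; last first.
  by split=> [|l lk]; rewrite lfunE /= ffunE fN // gl.
apply/(cocycleP F2 BS) => x y z.
rewrite -[RHS](proj2 (jacobiator_idx_cocycle gs) gM x y z) /jacobiator.
by congr (_ - _ * _ + _ * _); apply: eq_bigr => t _; rewrite fE.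
Qed.

End Dimension.

(** * The number of relation pairs *)

Local Open Scope nat_scope.

Lemma card_sum (T : finType) (P : pred T) : #|[set x | P x]| = \sum_x P x.
Proof. by rewrite cardsE -sum1_card big_mkcond. Qed.

Lemma card_sum2 (T : finType) (P : rel T) :
  #|[set xy : T * T | P xy.1 xy.2]| = \sum_x \sum_y P x y.
Proof. by rewrite card_sum pair_big. Qed.

Lemma sum2_diag (T : finType) (P : pred T) : \sum_x \sum_y (P x && (x == y)) = \sum_x P x.
Proof.
apply: eq_bigr => x _; rewrite (bigD1 x) //= eqxx andbT big1 ?addn0 // => y yx.
by rewrite eq_sym (negPf yx) andbF.
Qed.

(** Counts unordered pairs, with the diagonal kept only where P holds; the additive form avoids
    halving and truncated subtraction. *)
Lemma sum2_order (T : finType) (le W : rel T) (P : pred T) :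
  total le -> antisymmetric le -> symmetric W ->
  \sum_x \sum_y W x y + \sum_x (W x x && P x) =
  2 * (\sum_x \sum_y (W x y && (le x y && ((x != y) || P x)))) + \sum_x (W x x && ~~ P x).
Proof.
move=> tot anti sym.
have E1 : \sum_x \sum_y W x y = \sum_x \sum_y (W x y && (le x y && (x != y)))
    + \sum_x \sum_y (W x y && (le y x && (y != x))) + \sum_x \sum_y (W x x && (x == y)).
  rewrite -!big_split; apply: eq_bigr => x _; rewrite -!big_split; apply: eq_bigr => y _ /=.
  have [->|xy] := eqVneq x y; first by rewrite !andbF andbT.
  have := tot x y; have := @anti x y; rewrite !andbT !andbF addn0.
  by case: (W x y); case: (le x y); case: (le y x) => //= /(_ isT) E; rewrite E eqxx in xy.
have E2 : \sum_x \sum_y (W x y && (le y x && (y != x))) = \sum_x \sum_y (W x y && (le x y && (x != y))).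
  rewrite exchange_big; apply: eq_bigr => x _; apply: eq_bigr => y _; by rewrite sym.
have E3 : \sum_x \sum_y (W x y && (le x y && ((x != y) || P x))) =
    \sum_x \sum_y (W x y && (le x y && (x != y))) + \sum_x \sum_y ((W x x && P x) && (x == y)).
  rewrite -big_split; apply: eq_bigr => x _; rewrite -big_split; apply: eq_bigr => y _ /=.
  have [->|xy] := eqVneq x y; last by rewrite !andbF addn0.
  by have := tot y y; rewrite orbb => ->; rewrite /= andbF andbT.
have E4 : \sum_x W x x = \sum_x (W x x && P x) + \sum_x (W x x && ~~ P x).
  by rewrite -big_split; apply: eq_bigr => x _; case: (W x x); case: (P x).
rewrite E3 E1 E2 !sum2_diag E4; lia.
Qed.

Lemma sum_interval lo hi N : \sum_(k < N) ((lo <= k) && (k < hi)) = minn N hi - lo.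
Proof. by elim: N => [|N IH]; rewrite ?big_ord0 ?big_ord_recr /= ?IH; lia. Qed.

Lemma sum_shift p q s : \sum_(i < p) \sum_(j < q) (j == i + s :> nat) = minn p (q - s).
Proof.
have E (i : 'I_p) : \sum_(j < q) (j == i + s :> nat) = (i < q - s).
  transitivity (\sum_(j < q) ((i + s <= j) && (j < (i + s).+1))).
    by apply: eq_bigr => j _; congr nat_of_bool; lia.
  by rewrite sum_interval; lia.
under eq_bigr do rewrite E.
transitivity (\sum_(i < p) ((0 <= i) && (i < q - s))); first exact: eq_bigr.
by rewrite sum_interval subn0.
Qed.

Section Count.

Variables (m n : nat).
Local Notation I := 'I_(m + n).
Local Notation nilb := (Defs.nil_basis m n).
Local Notation lv := (@idx_val m n).
Local Notation od := (@odd_idx m n).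
Local Notation par := (@nil_par m n).

Lemma sum_idx (f : nat -> bool -> nat) :
  \sum_(a : I) f (lv a) (od a) = \sum_(k < m) f k false + \sum_(k < n) f k true.
Proof.
rewrite big_split_ord; congr (_ + _); apply: eq_bigr => k _;
  by rewrite /idx_val /odd_idx -/(unsplit (inl _)) -/(unsplit (inr _)) unsplitK.
Qed.

Lemma sum_idx2 (P : bool -> bool -> bool) s :
  \sum_(a : I) \sum_(b : I) ((lv b == lv a + s) && P (od a) (od b)) =
  P false false * minn m (m - s) + P false true * minn m (n - s)
  + P true false * minn n (m - s) + P true true * minn n (n - s).
Proof.
rewrite (sum_idx (fun k o => \sum_(b : I) ((lv b == k + s) && P o (od b)))).
have E k o : \sum_(b : I) ((lv b == k + s) && P o (od b)) =
    P o false * (\sum_(j < m) (j == k + s :> nat)) + P o true * (\sum_(j < n) (j == k + s :> nat)).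
  rewrite (sum_idx (fun l o' => (l == k + s) && P o o')) !big_distrr /=.
  by congr (_ + _); apply: eq_bigr => j _; case: (_ == _); case: (P _ _).
rewrite !(eq_bigr _ (fun i _ => E _ _)) !big_split /= -!big_distrr /= !sum_shift; lia.
Qed.

Lemma sum_nilb (Q : pred nilb) (P : I -> I -> bool) :
  (forall x, Q x = P (val x).1 (val x).2) -> (forall a b, P a b -> lv a < lv b) ->
  \sum_(x : nilb) Q x = \sum_a \sum_b P a b.
Proof.
move=> QP Plt; transitivity (\sum_(x : nilb) P (val x).1 (val x).2).
  by apply: eq_bigr => x _; rewrite QP.
rewrite pair_big /= [RHS](bigID (fun ab => lv ab.1 < lv ab.2)) /=.
rewrite [X in _ = _ + X]big1 ?addn0 => [|[a b] /= nab]; last first.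
  by case: (boolP (P a b)) => // /Plt ab; rewrite ab in nab.
rewrite [RHS](reindex_omap (val : nilb -> I * I) insub) /=.
  by apply: eq_bigl => x; rewrite valK eqxx andbT (valP x).
by move=> ab lt; rewrite insubT.
Qed.

Lemma sum_simple_even :
  \sum_(x : nilb) (simple x && ~~ par x) = minn m m.-1 + minn n n.-1.
Proof.
rewrite (sum_nilb (P := fun a b => (lv b == lv a + 1) && ~~ (od a (+) od b))) => [|x|a b].
- rewrite (sum_idx2 (fun p q => ~~ (p (+) q))) /= !subn1; lia.
- by rewrite /simple addn1.
by case/andP => /eqP ->; rewrite addn1.
Qed.

Lemma sum_simple_odd :
  \sum_(x : nilb) (simple x && par x) = minn m n.-1 + minn n m.-1.
Proof.
rewrite (sum_nilb (P := fun a b => (lv b == lv a + 1) && (od a (+) od b))) => [|x|a b].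
- rewrite (sum_idx2 (fun p q => p (+) q)) /= !subn1; lia.
- by rewrite /simple addn1.
by case/andP => /eqP ->; rewrite addn1.
Qed.

Hypothesis lt_nm : n < m.

(** The middle index is the unique even one of its level, so such a pair amounts to its endpoints
    (a, d), two levels apart. *)
Lemma sum_via_even :
  \sum_(x : nilb) \sum_(y : nilb) [&& simple x, simple y & via_even x y] =
  (m - 2) + minn m (n - 2) + minn n (m - 2) + (n - 2).
Proof.
transitivity (\sum_(a : I) \sum_(b : I) ((lv b == lv a + 2) && true)); last first.
  by rewrite (sum_idx2 (fun _ _ => true)) /= !mul1n; lia.
rewrite -!card_sum2 -(card_in_imset (f := fun xy : nilb * nilb => ((val xy.1).1, (val xy.2).2))).
  apply: eq_card => -[a d]; rewrite inE /= andbT; apply/imsetP/eqP => [[[x y]]|ad].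
    rewrite inE /= => /and3P[/eqP sx /eqP sy /andP[/eqP E _]] [-> ->].
    by rewrite sy -E sx addn2.
  have dm := idx_lt lt_nm d.
  have [e le oe] : exists2 e : I, lv e = (lv a).+1 & ~~ od e by apply: even_idx_ex; lia.
  have ae : (lv a < lv e)%N by lia.
  have ed : (lv e < lv d)%N by lia.
  exists (Sub (a, e) ae, Sub (e, d) ed); last by rewrite !SubK.
  by rewrite inE /= /simple /via_even !SubK /= le ad addn2 !eqxx oe.
move=> [[[a b] ab] [[c d] cd]] [[[a' b'] ab'] [[c' d'] cd']]; rewrite !inE /simple /via_even /=.
move=> /and3P[/eqP sx /eqP sy /andP[/eqP E ob]] /and3P[/eqP sx' /eqP sy' /andP[/eqP E' ob']] [Ea Ed].
subst c c' a' d'.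
have bb : b = b' by apply: idx_inj; rewrite ?sx ?sx' // (negPf ob) (negPf ob').
by subst b'; congr (_, _); apply: val_inj.
Qed.

Lemma quadratic_pair_sym : symmetric (@quadratic_pair m n).
Proof.
move=> x y; rewrite /quadratic_pair; case: (simple x); case: (simple y) => //=.
exact: andbC.
Qed.

Lemma quadratic_pair_diag x : @quadratic_pair m n x x = simple x.
Proof.
rewrite /quadratic_pair /via_even lv_neq /=; first by case: (simple x).
by rewrite gtn_eqF // (valP x).
Qed.

(** All pairs of generators, less those meeting in an even index in one order or the other; both at
    once is excluded by levels. *)
Lemma sum_quadratic_pair :
  \sum_(x : nilb) \sum_(y : nilb) quadratic_pair x y
    + 2 * \sum_(x : nilb) \sum_(y : nilb) [&& simple x, simple y & via_even x y]
  = (\sum_(x : nilb) simple x) ^ 2.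
Proof.
rewrite expnS expn1 big_distrlr /= mul2n -addnn.
rewrite [X in _ + (_ + X)]exchange_big /= -!big_split; apply: eq_bigr => x _.
rewrite -!big_split; apply: eq_bigr => y _ /=.
rewrite /quadratic_pair; case sx: (simple x); case sy: (simple y) => //=.
case xy: (via_even x y); case yx: (via_even y x) => //=.
case/andP: xy => /eqP xy _; case/andP: yx => /eqP yx _.
by have := valP x; have := valP y; rewrite xy yx; lia.
Qed.

Lemma card_serre_out :
  #|[set xy : nilb * nilb | serre_out xy.1 xy.2]| =
  \sum_(a : I) ((n <= (lv a).+1) && ((lv a).+2 < m)).
Proof.
rewrite -card_sum -(card_in_imset (f := fun xy : nilb * nilb => (val xy.1).1)).
  apply: eq_card => a; rewrite inE; apply/imsetP/andP => [[[x y]]|[na am]].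
    rewrite inE /serre_out => /and4P[nx /eqP E1 _ _] -> /=; split=> //.
    by rewrite -E1 idx_lt.
  have [b lb ob] := even_idx_ex n am.
  have [e le oe] : exists2 e : I, lv e = (lv a).+1 & ~~ od e by apply: even_idx_ex; lia.
  have ab : lv a < lv b by lia.
  have eb : lv e < lv b by lia.
  exists (Sub (a, b) ab, Sub (e, b) eb); last by rewrite SubK.
  by rewrite inE /serre_out !SubK /= na lb le !eqxx.
move=> [[[a b] ab] [[c d] cd]] [[[a' b'] ab'] [[c' d'] cd']]; rewrite !inE /serre_out /=.
move=> /and4P[na /eqP lb /eqP E1 /eqP lc] /and4P[na' /eqP lb' /eqP E1' /eqP lc'] Ea.
subst a' d d'; have bb : b = b' by apply: idx_inj_ge; lia.
have cc : c = c' by apply: idx_inj_ge; lia.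
by subst b' c'; congr (_, _); apply: val_inj.
Qed.

Lemma card_serre_in :
  #|[set xy : nilb * nilb | serre_in xy.1 xy.2]| =
  \sum_(a : I) ((n <= (lv a).+1) && ((lv a).+2 < m)).
Proof.
rewrite -card_sum -(card_in_imset (f := fun xy : nilb * nilb => (val xy.1).1)).
  apply: eq_card => a; rewrite inE; apply/imsetP/andP => [[[x y]]|[na am]].
    rewrite inE /serre_in => /and5P[nx /eqP E1 _ _ _] -> /=; split=> //.
    by rewrite -E1 idx_lt.
  have [b lb ob] := even_idx_ex n am.
  have [e le oe] : exists2 e : I, lv e = (lv a).+1 & ~~ od e by apply: even_idx_ex; lia.
  have [c lc oc] := even_idx_ex n (idx_lt lt_nm a).
  have ab : lv a < lv b by lia.
  have ce : lv c < lv e by lia.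
  exists (Sub (a, b) ab, Sub (c, e) ce); last by rewrite SubK.
  by rewrite inE /serre_in !SubK /= na lb le lc oc !eqxx.
move=> [[[a b] ab] [[c d] cd]] [[[a' b'] ab'] [[c' d'] cd']]; rewrite !inE /serre_in /=.
move=> /and5P[na /eqP lb /eqP lc oc /eqP ld] /and5P[na' /eqP lb' /eqP lc' oc' /eqP ld'] Ea.
subst a'; have bb : b = b' by apply: idx_inj_ge; lia.
have dd : d = d' by apply: idx_inj_ge; lia.
have cc : c = c' by apply: idx_inj; rewrite ?lc ?lc' // (negPf oc) (negPf oc').
by subst b' c' d'; congr (_, _); apply: val_inj.
Qed.

Lemma sum_serre :
  \sum_(a : I) ((n <= (lv a).+1) && ((lv a).+2 < m)) =
  (m - 2 - (n - 1)) + (minn n (m - 2) - (n - 1)).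
Proof.
rewrite (sum_idx (fun k _ => (n <= k.+1) && (k.+2 < m))).
(* For N = n this counts odd a, where only level n-1 can contribute. *)
have E N : \sum_(k < N) ((n <= k.+1) && (k.+2 < m)) = minn N (m - 2) - (n - 1).
  rewrite -sum_interval; apply: eq_bigr => k _; congr nat_of_bool; lia.
by rewrite !E; lia.
Qed.

Lemma card_relation_split :
  #|{: relation m n}| = \sum_(x : nilb) \sum_(y : nilb)
      (quadratic_pair x y && (before par x y && ((x != y) || par x)))
    + 2 * (\sum_(a : I) ((n <= (lv a).+1) && ((lv a).+2 < m))).
Proof.
rewrite card_sig -cardsE (card_sum2 (@relation_pair m n)).
rewrite mul2n -addnn -{1}card_serre_out -card_serre_in !card_sum2 -!big_split.
apply: eq_bigr => x _; rewrite -!big_split; apply: eq_bigr => y _ /=.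
rewrite /relation_pair; set q := _ && (_ && _).
have qx : q -> lv (val x).2 = (lv (val x).1).+1 by case/andP => /and4P[/eqP].
have sx : serre_out x y -> lv (val x).2 = (lv (val x).1).+2 /\ lv (val y).1 = (lv (val x).1).+1.
  by case/and4P => _ /eqP-> _ /eqP->.
have tx : serre_in x y -> lv (val x).2 = (lv (val x).1).+2 /\ lv (val y).1 = lv (val x).1.
  by case/and5P => _ /eqP-> /eqP-> _ _.
move: qx sx tx; case: q; case: (serre_out x y); case: (serre_in x y) => //= qx sx tx; exfalso.
all: try have := qx isT; try have := sx isT; try have := tx isT; lia.
Qed.

Lemma card_relation :
  2 * #|{: relation m n}| + (m.-1 + n.-1)
    + 2 * ((m - 2) + minn m (n - 2) + minn n (m - 2) + (n - 2)) =
  (m.-1 + n.-1 + (minn m n.-1 + minn n m.-1)) ^ 2 + (minn m n.-1 + minn n m.-1)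
    + 4 * ((m - 2 - (n - 1)) + (minn n (m - 2) - (n - 1))).
Proof.
have S : \sum_(x : nilb) simple x =
    \sum_(x : nilb) (simple x && ~~ par x) + \sum_(x : nilb) (simple x && par x).
  by rewrite -big_split; apply: eq_bigr => x _; case: (simple x); case: (par x).
have := sum_quadratic_pair; rewrite S sum_via_even sum_simple_even sum_simple_odd.
have := sum2_order par (@before_total _ par) (@before_anti _ par) quadratic_pair_sym.
under [X in _ + X = _]eq_bigr do rewrite quadratic_pair_diag.
under [X in _ = _ + X]eq_bigr do rewrite quadratic_pair_diag.
rewrite sum_simple_even sum_simple_odd card_relation_split sum_serre.
have -> : minn m m.-1 = m.-1 by lia.
have -> : minn n n.-1 = n.-1 by lia.
set q := \sum_x \sum_y _; set w := \sum_x \sum_y _; set o := minn m n.-1 + _; set e := m.-1 + _.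
set v := _ - 2 + _ + _ + _; set s := _ - _ + _; move: ((e + o) ^ 2) => t.
lia.
Qed.

End Count.

(** * The closed formula *)

Local Open Scope ring_scope.

Theorem mainTheorem8 (R : realType) (n rho : nat) (hn : (2 <= n)%N)
    (hrho : (1 <= rho)%N) :
  (\dim (nil_cohomology R[i] (n + rho) n 2))%:R =
    (if rho == 1%N then 8 * n%:R ^+ 2 - 12 * n%:R + 8
     else if rho == 2%N then 8 * n%:R ^+ 2 - 8 * n%:R + 8
     else 8 * n%:R ^+ 2 - 8 * n%:R + 8 + 4 * n%:R * (rho%:R - 2)
          + ((rho%:R - 3) ^+ 2 + (rho%:R - 3)) / 2) :> rat.
Proof.
have lt_nm : (n < n + rho)%N by lia.
have F2 : (2%:R : R[i]) != 0 by rewrite pnatr_eq0.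
rewrite (dim_cohomology2 F2 lt_nm).
have := card_relation lt_nm; move: #|_| => T.
case: n hn {lt_nm} => [//|[//|k]] _.
have -> : ((k.+2 + rho).-1 + k.+1 = 2 * k + rho + 2)%N by lia.
have -> : (minn (k.+2 + rho) k.+1 + minn k.+2 (k.+2 + rho).-1 = 2 * k + 3)%N by lia.
(* The cases differ through [minn n (m - 2)], which is n-1 for rho = 1 and n afterwards. *)
case: rho hrho => [//|[|[|r]]] _ /=.
- have -> : (k.+2 + 1 - 2 + minn (k.+2 + 1) (k.+2 - 2) + minn k.+2 (k.+2 + 1 - 2) + (k.+2 - 2) = 4 * k + 2)%N by lia.
  have -> : (k.+2 + 1 - 2 - (k.+2 - 1) + (minn k.+2 (k.+2 + 1 - 2) - (k.+2 - 1)) = 0)%N by lia.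
  move=> /(congr1 (fun t => t%:R : rat)); rewrite -[k.+2]addn2.
  rewrite !(natrD, natrX, natrM) => H; lra.
- have -> : (k.+2 + 2 - 2 + minn (k.+2 + 2) (k.+2 - 2) + minn k.+2 (k.+2 + 2 - 2) + (k.+2 - 2) = 4 * k + 4)%N by lia.
  have -> : (k.+2 + 2 - 2 - (k.+2 - 1) + (minn k.+2 (k.+2 + 2 - 2) - (k.+2 - 1)) = 2)%N by lia.
  move=> /(congr1 (fun t => t%:R : rat)); rewrite -[k.+2]addn2.
  rewrite !(natrD, natrX, natrM) => H; lra.
have -> : (k.+2 + r.+3 - 2 + minn (k.+2 + r.+3) (k.+2 - 2) + minn k.+2 (k.+2 + r.+3 - 2) + (k.+2 - 2) = 4 * k + r + 5)%N by lia.
have -> : (k.+2 + r.+3 - 2 - (k.+2 - 1) + (minn k.+2 (k.+2 + r.+3 - 2) - (k.+2 - 1)) = r + 3)%N by lia.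
move=> /(congr1 (fun t => t%:R : rat)); rewrite -[k.+2]addn2 -[r.+3]addn3.
rewrite !(natrD, natrX, natrM) => H; lra.
Qed.
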